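(* For a Banach space $E$, the following are equivalent: (1) $E$ contains a complemented subspace isomorphic to $\ell_1$. (2) $\mathrm{FBL}[E]$ contains a lattice complemented sublattice (lattice) isomorphic to $\mathrm{FBL}[\ell_1]$. (3) $\mathrm{FBL}[E]$ contains a lattice complemented sublattice (lattice) isomorphic to $\ell_1$. (4) $\ell_1$ is a lattice quotient of $\mathrm{FBL}[E]$, i.e. there is a surjective lattice homomorphism $\mathrm{FBL}[E]\to\ell_1$. (5) $\ell_1$ is (lattice isomorphic to) a closed sublattice of $\mathrm{FBL}[E]$. (6) $\ell_1$ is (linearly isomorphic to) a complemented subspace of $\mathrm{FBL}[E]$.
   Context: Banach spaces are real. $\ell_1$ carries its coordinatewise order. $H[E]$ is the vector lattice (pointwise operations) of positively homogeneous functions $f:E^*\to\mathbb R$, with $\|f\|_{\mathrm{FBL}[E]}=\sup\{\sum_{k=1}^n|f(x_k^* )|: n\in\mathbb N,\ x_1^*,\dots,x_n^*\in E^*,\ \sup_{x\in B_E}\sum_{k=1}^n|x_k^*(x)|\le 1\}$. For $x\in E$ let $\delta_x(x^* )=x^*(x)$. $\mathrm{FBL}[E]$ is the closure, in the space of $f\in H[E]$ with finite norm, of the sublattice generated by $\{\delta_x:x\in E\}$; with $\phi_E(x)=\delta_x$ it is the free Banach lattice over $E$: every bounded linear $T:E\to X$ into a Banach lattice $X$ extends uniquely to a lattice homomorphism $\widehat T:\mathrm{FBL}[E]\to X$ with $\widehat T\phi_E=T$, and $\|\widehat T\|=\|T\|$. A lattice isomorphism is a lattice homomorphism that is a Banach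 space isomorphism. A sublattice $Y$ of a Banach lattice $X$ is lattice complemented if there is an idempotent lattice homomorphism from $X$ onto $Y$. *)

(* Defs.v *)
From HB Require Import structures.
From mathcomp Require Import all_boot all_order all_algebra.
From mathcomp Require Import boolp classical_sets functions reals constructive_ereal ereal.
From mathcomp Require Import topology tvs normedtype sequences.
From mathcomp Require Import lra.

Set Implicit Arguments.
Unset Strict Implicit.
Unset Printing Implicit Defensive.

Import Order.TTheory GRing.Theory Num.Theory.
Import numFieldNormedType.Exports.

Local Open Scope classical_set_scope.
Local Open Scope ring_scope.

(* The order is part of the mixin, rather than Order.Lattice, because HB has *)
(* no join of Order.Lattice with the algebraic structures below              *)
(* CompleteNormedModule other than through Num.RealDomain.                   *)
HB.mixin Record isBanachLattice (R : realType) T & CompleteNormedModule R T := {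
  vle : T -> T -> Prop;
  vmeet : T -> T -> T;
  vjoin : T -> T -> T;
  vle_refl : forall x, vle x x;
  vle_anti : forall x y, vle x y -> vle y x -> x = y;
  vle_trans : forall y x z, vle x y -> vle y z -> vle x z;
  vmeetP : forall x y z, vle z (vmeet x y) <-> vle z x /\ vle z y;
  vjoinP : forall x y z, vle (vjoin x y) z <-> vle x z /\ vle y z;
  vleD2r : forall z x y, vle x y -> vle (x + z) (y + z);
  vleZ : forall (a : R) x y, 0 <= a -> vle x y -> vle (a *: x) (a *: y);
  norm_monotone : forall x y,
    vle (vjoin x (- x)) (vjoin y (- y)) -> `|x| <= `|y|
}.

#[short(type="banachLatticeType")]
HB.structure Definition BanachLattice (R : realType) :=
  {T of CompleteNormedModule R T & isBanachLattice R T}.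

Section Subspaces.
Context {R : realType}.
Implicit Types X Y : normedModType R.

Definition is_subspace Y (S : set Y) : Prop :=
  S 0 /\ forall (a : R) (x y : Y), S x -> S y -> S (a *: x + y).

(* [T] is a linear homeomorphism of [X] onto [S]. *)
Definition iso_onto X Y (T : {linear X -> Y}) (S : set Y) : Prop :=
  [/\ continuous T, range T = S &
      exists U : Y -> X, {within S, continuous U} /\ cancel T U].

Definition complemented X (S : set X) : Prop :=
  exists P : {linear X -> X},
    [/\ continuous P, (forall x, P (P x) = P x) & range P = S].

Definition contains_complemented X Y : Prop :=
  exists S : set Y, [/\ is_subspace S, complemented S &
    exists T : {linear X -> Y}, iso_onto T S].

End Subspaces.

Section Sublattices.
Context {R : realType}.
Implicit Types X Y : banachLatticeType R.

Definition lattice_hom X Y (T : {linear X -> Y}) : Prop :=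
  {morph T : x y / vmeet x y} /\ {morph T : x y / vjoin x y}.

Definition is_sublattice Y (S : set Y) : Prop :=
  is_subspace S /\
  forall x y, S x -> S y -> S (vmeet x y) /\ S (vjoin x y).

Definition lattice_isomorphic X Y (S : set Y) : Prop :=
  exists T : {linear X -> Y}, lattice_hom T /\ iso_onto T S.

Definition lattice_complemented X (S : set X) : Prop :=
  exists P : {linear X -> X},
    [/\ lattice_hom P, (forall x, P (P x) = P x) & range P = S].

End Sublattices.

Section Dual.
Context {R : realType} (E : normedModType R).

Definition dual_pred : {pred E -> R} :=
  mem [set f : E -> R | linear f /\ continuous f].

Lemma dual_submod_closed : submod_closed dual_pred.
Proof.
split.
  rewrite inE; split=> [a x y|]; rewrite ?scaler0 ?addr0//.
  exact: cst_continuous.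
move=> a f g; rewrite !inE => -[lf cf] [lg cg]; split.
  move=> b x y; rewrite !fctE/= lf lg.
  by rewrite !scalerDr !scalerA mulrC addrACA.
move=> x; apply: cvgD; last exact: cg.
by apply: cvgZr; exact: cf.
Qed.

HB.instance Definition _ :=
  GRing.isSubmodClosed.Build R (E -> R) dual_pred dual_submod_closed.

Record dual : Type :=
  Dual { dual_fun :> E -> R; dualP : dual_fun \in dual_pred }.

HB.instance Definition _ := [isSub for dual_fun].
HB.instance Definition _ := [Choice of dual by <:].
HB.instance Definition _ := [SubChoice_isSubLmodule of dual by <:].

Lemma dualDE (f g : dual) x : (f + g) x = f x + g x. Proof. by []. Qed.
Lemma dualZE a (f : dual) x : (a *: f) x = a * f x. Proof. by []. Qed.

End Dual.

Section SupSum.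
Context {R : realType} {T : Type} (F : set (seq T)).
Implicit Types f g : T -> R.

Definition supsum f : \bar R :=
  ereal_sup [set (\sum_(t <- s) `|f t|)%:E | s in F].
Arguments supsum f%_R.

Lemma supsum_ubound f s : F s -> ((\sum_(t <- s) `|f t|)%:E <= supsum f)%E.
Proof. by move=> Fs; apply: ereal_sup_ubound; exists s. Qed.

Lemma supsum_le f (b : \bar R) :
  (forall s, F s -> ((\sum_(t <- s) `|f t|)%:E <= b)%E) -> (supsum f <= b)%E.
Proof. by move=> fb; apply: ge_ereal_sup => _ [s Fs <-]; exact: fb. Qed.

Lemma supsum_monotone f g :
  (forall t, `|f t| <= `|g t|) -> (supsum f <= supsum g)%E.
Proof.
move=> fg; apply: supsum_le => s Fs; apply: le_trans (supsum_ubound _ Fs).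
by rewrite lee_fin; apply: ler_sum.
Qed.

Hypothesis F0 : F [::].

Lemma supsum_ge0 f : (0 <= supsum f)%E.
Proof. by have := supsum_ubound f F0; rewrite big_nil. Qed.

Lemma supsumD f g : (supsum (f + g) <= supsum f + supsum g)%E.
Proof.
apply: supsum_le => s Fs.
apply: (@le_trans _ _ ((\sum_(t <- s) `|f t|)%:E + (\sum_(t <- s) `|g t|)%:E)%E).
  by rewrite -EFinD lee_fin -big_split/=; apply: ler_sum => t _; exact: ler_normD.
by apply: leeD; exact: supsum_ubound.
Qed.

Lemma supsum0 : supsum 0 = 0%E.
Proof.
apply/eqP; rewrite eq_le supsum_ge0 andbT.
by apply: supsum_le => s _; rewrite big1// => t _; rewrite normr0.
Qed.

Lemma supsumZ_le (a : R) f : (supsum (a *: f) <= `|a|%:E * supsum f)%E.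
Proof.
apply: supsum_le => s Fs.
rewrite (eq_bigr (fun t => `|a| * `|f t|)); last by move=> t _; rewrite -normrM.
by rewrite -mulr_sumr EFinM lee_wpmul2l ?lee_fin//; exact: supsum_ubound.
Qed.

Lemma supsumZ (a : R) f : supsum (a *: f) = (`|a|%:E * supsum f)%E.
Proof.
have [->|a0] := eqVneq a 0; first by rewrite scale0r supsum0 normr0 mul0e.
apply/eqP; rewrite eq_le supsumZ_le/=.
have := supsumZ_le a^-1 (a *: f); rewrite scalerA mulVf// scale1r => h.
apply: (@le_trans _ _ (`|a|%:E * (`|a^-1|%:E * supsum (a *: f)))%E).
  by rewrite lee_wpmul2l ?lee_fin.
by rewrite muleA -EFinM -normrM divff// normr1 mul1e.
Qed.

Lemma supsum_lattice f f' g g' :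
  (supsum ((f \max g) - (f' \max g'))%R <= supsum (f - f') + supsum (g - g'))%E /\
  (supsum ((f \min g) - (f' \min g'))%R <= supsum (f - f') + supsum (g - g'))%E.
Proof.
pose h := (fun t => `|f t - f' t|) : T -> R; pose k := (fun t => `|g t - g' t|) : T -> R.
have hk : (supsum (h + k) <= supsum (f - f') + supsum (g - g'))%E.
  by apply: le_trans (supsumD _ _) _; apply: leeD; apply: supsum_monotone => t;
    rewrite normr_id.
by split; apply: le_trans hk; apply: supsum_monotone => t; rewrite !fctE/= /h /k;
  rewrite [leRHS]ger0_norm ?addr_ge0// ler_norml;
  have := (ler_norm (f t - f' t), ler_norm (g t - g' t));
  have := (ler_norm (f' t - f t), ler_norm (g' t - g t));
  rewrite (distrC (f' t)) (distrC (g' t)) => -[? ?] [? ?];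
  case: (lerP (f t) (g t)); case: (lerP (f' t) (g' t)); lra.
Qed.

(* The hypotheses say that [V] is a space of functions on [T] normed by      *)
(* [supsum] and closed for it.                                               *)
Lemma supsum_complete (V : normedModType R) (v : V -> T -> R) :
  {morph v : x y / x - y >-> x - y} ->
  (forall x, supsum (v x) = `|x|%:E) ->
  (forall t, exists2 c : R, 0 < c & forall x, `|v x t| <= c * `|x|) ->
  forall G : set_system V, ProperFilter G ->
  (forall f, (forall t, v x t @[x --> G] --> f t) ->
     (forall e : R, 0 < e -> exists x, (supsum (f - v x) <= e%:E)%E) ->
     exists x, v x = f) ->
  cauchy G -> cvg G.
Proof.
move=> vB vN vc G GP vcl /cauchy_ballP Gc.
have pw t : cvg ((fun x => v x t) @ G).
  apply/cauchy_cvgP/cauchy_ballP => e e0; have [c c0 vct] := vc t.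
  have [[A B]/= [GA GB] AB] := Gc _ (divr_gt0 e0 c0).
  exists ((fun x => v x t) @` A, (fun x => v x t) @` B) => /=.
    by split; [apply: filterS GA|apply: filterS GB] => x; exists x.
  move=> [_ _]/= [[x Ax <-] [y By <-]].
  rewrite -ball_normE/=.
  have := AB (x, y) (conj Ax By); rewrite -ball_normE/= ltr_pdivlMr// mulrC.
  by apply: le_lt_trans; have := vct (x - y); rewrite vB.
pose f t : R := lim ((fun x => v x t) @ G).
have fcl (e : R) : 0 < e -> \forall x \near G, (supsum (f - v x) <= e%:E)%E.
  move=> e0; have [[A B]/= [GA GB] AB] := Gc _ e0.
  apply: filterS GA => x Ax; apply: supsum_le => s Fs; rewrite lee_fin.
  have cs : (\sum_(t <- s) `|v y t - v x t|) @[y --> G] -->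
            \sum_(t <- s) `|f t - v x t|.
    by apply: cvg_big => [|t _]; [exact: add_continuous|]; apply: cvg_norm; apply: cvgB; [exact: pw|exact: cvg_cst].
  change (\sum_(t <- s) `|f t - v x t| <= e).
  have := @closed_cvg _ _ _ GP _ (fun r : R => r <= e) (@closed_le _ e) _ _ cs.
  apply.
  apply: filterS GB => y By; rewrite /=.
  have := AB (x, y) (conj Ax By); rewrite -ball_normE/= => /ltW; apply: le_trans.
  rewrite -lee_fin distrC -vN; have := supsum_ubound (v (y - x)) Fs.
  by rewrite vB.
have [z vz] : exists z, v z = f.
  apply: vcl => [t|e e0]; first exact: pw.
   have [x fx] := @filter_ex _ _ GP _ (fcl e e0).
  by exists x.
apply/cvg_ex; exists z; apply/cvgrPdist_le => e e0; near=> x.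
by rewrite -lee_fin -vN vB vz; near: x; exact: fcl.
Unshelve. all: by end_near. Qed.

End SupSum.
Arguments supsum {R T} F f%_R.

Section Ell1.
Context {R : realType}.

Definition ell1_norm (x : nat -> R) : \bar R := (\sum_(0 <= k <oo) `|x k|%:E)%E.

Let iotas : set (seq nat) := range (index_iota 0).

Let iotas0 : iotas [::]. Proof. by exists 0%N. Qed.

Lemma ell1_normE x : ell1_norm x = supsum iotas x.
Proof.
rewrite /ell1_norm (cvg_lim _ (ereal_nondecreasing_cvgn _))//; last first.
  by apply: ereal_nondecreasing_series => n _ _; rewrite lee_fin.
rewrite /supsum; congr ereal_sup; apply/seteqP; split => [_ [n _ <-]|_ [_ [n _ <-] <-]].
  by exists (index_iota 0 n); [exists n|rewrite sumEFin].
by exists n => //; rewrite sumEFin.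
Qed.

Definition ell1_pred : {pred nat -> R} :=
  mem [set x : nat -> R | (ell1_norm x < +oo)%E].

Lemma ell1_submod_closed : submod_closed ell1_pred.
Proof.
split; first by rewrite inE/= ell1_normE supsum0// ltry.
move=> a f g; rewrite !inE/= !ell1_normE => ff gf.
apply: le_lt_trans (supsumD iotas _ _) _; apply: lte_add_pinfty => //.
by rewrite supsumZ//; apply: lte_mul_pinfty => //; rewrite lee_fin.
Qed.

HB.instance Definition _ :=
  GRing.isSubmodClosed.Build R (nat -> R) ell1_pred ell1_submod_closed.

End Ell1.

Record ell1 (R : realType) : Type :=
  Ell1 { ell1_fun :> nat -> R; ell1P : ell1_fun \in ell1_pred }.

HB.instance Definition _ R := [isSub for @ell1_fun R].
HB.instance Definition _ R := [Choice of ell1 R by <:].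
HB.instance Definition _ R := [SubChoice_isSubLmodule of ell1 R by <:].

Section Ell1Lattice.
Context {R : realType}.
Implicit Types x y z : ell1 R.

Let F : set (seq nat) := range (index_iota 0).
Let F0 : F [::]. Proof. by exists 0%N. Qed.

Let nrm x : R := fine (ell1_norm x).

Let nrmE x : supsum F x = (nrm x)%:E.
Proof.
rewrite /nrm ell1_normE fineK// ge0_fin_numE ?supsum_ge0//.
by rewrite -ell1_normE; have := ell1P x; rewrite inE.
Qed.

Let coord_le x n : `|x n| <= nrm x.
Proof.
rewrite -lee_fin -nrmE; apply: le_trans (supsum_ubound _ (_ : F (index_iota 0 n.+1))).
  by rewrite lee_fin big_nat_recr//= lerDr sumr_ge0.
by exists n.+1.
Qed.

Let nrmD x y : nrm (x + y) <= nrm x + nrm y.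
Proof. by rewrite -lee_fin EFinD -!nrmE; exact: supsumD. Qed.

Let nrmZ a x : nrm (a *: x) = `|a| * nrm x.
Proof. by apply: EFin_inj; rewrite EFinM -!nrmE -supsumZ. Qed.

Let nrm0 x : nrm x = 0 -> x = 0.
Proof.
move=> x0; apply/val_inj/funext => n /=; apply/eqP; rewrite -normr_le0.
by rewrite -x0 coord_le.
Qed.

HB.instance Definition _ := Lmodule_isNormed.Build R (ell1 R) nrmD nrmZ nrm0.

Let cplt (G : set_system (ell1 R)) : ProperFilter G -> cauchy G -> cvg G.
Proof.
move=> GP; apply: (@supsum_complete _ _ F _ (@ell1_fun R)) => //.
- by move=> n; exists 1 => // x; rewrite mul1r; exact: coord_le.
- move=> f _ fcl; have [x fx] := fcl 1 ltr01.
  suff fP : f \in ell1_pred by exists (Ell1 fP).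
  rewrite inE/= ell1_normE -(subrK (ell1_fun x) f).
  apply: le_lt_trans (supsumD F _ _) _; apply: lte_add_pinfty.
    by apply: le_lt_trans fx _; rewrite ltry.
  by have -> := nrmE x; rewrite ltry.
Qed.

HB.instance Definition _ := Uniform_isComplete.Build (ell1 R) cplt.

Let lat x y : ((x : nat -> R) \min (y : nat -> R)) \in ell1_pred /\
  ((x : nat -> R) \max (y : nat -> R)) \in ell1_pred.
Proof.
have xyoo : (supsum F x + supsum F y < +oo)%E by rewrite !nrmE -EFinD ltry.
have [hM hm] := supsum_lattice F x 0 y 0.
rewrite !subr0 in hM hm.
have M0 : ((0 : nat -> R) \max 0) = 0 by apply/funext => n /=; rewrite maxxx.
have m0 : ((0 : nat -> R) \min 0) = 0 by apply/funext => n /=; rewrite minxx.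
rewrite M0 subr0 in hM; rewrite m0 subr0 in hm.
by rewrite !inE/= !ell1_normE; split; apply: le_lt_trans xyoo.
Qed.

Definition ell1_le x y : Prop := forall n, x n <= y n.
Definition ell1_meet x y : ell1 R := Ell1 (lat x y).1.
Definition ell1_join x y : ell1 R := Ell1 (lat x y).2.

Let ple_refl x : ell1_le x x. Proof. by move=> n. Qed.

Let ple_anti x y : ell1_le x y -> ell1_le y x -> x = y.
Proof. by move=> xy yx; apply/val_inj/funext => n; apply/le_anti; rewrite xy yx. Qed.

Let ple_trans y x z : ell1_le x y -> ell1_le y z -> ell1_le x z.
Proof. by move=> xy yz n; exact: le_trans (xy n) (yz n). Qed.

Let meetP x y z : ell1_le z (ell1_meet x y) <-> ell1_le z x /\ ell1_le z y.
Proof.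
split=> [h|[h k] n]; last by rewrite /= le_min h k.
by split=> n; have := h n; rewrite /= le_min => /andP[].
Qed.

Let joinP x y z : ell1_le (ell1_join x y) z <-> ell1_le x z /\ ell1_le y z.
Proof.
split=> [h|[h k] n]; last by rewrite /= ge_max h k.
by split=> n; have := h n; rewrite /= ge_max => /andP[].
Qed.

Let leD2r z x y : ell1_le x y -> ell1_le (x + z) (y + z).
Proof. by move=> xy n; exact: lerD (xy n) (lexx _). Qed.

Let leZ (a : R) x y : 0 <= a -> ell1_le x y -> ell1_le (a *: x) (a *: y).
Proof. by move=> a0 xy n; exact: (ler_wpM2l a0 (xy n)). Qed.

Let nrm_mono x y : ell1_le (ell1_join x (- x)) (ell1_join y (- y)) -> `|x| <= `|y|.
Proof.
move=> xy; change (nrm x <= nrm y); rewrite -lee_fin -!nrmE.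
by apply: supsum_monotone => n; have := xy n; rewrite /= !maxrN.
Qed.

HB.instance Definition _ := isBanachLattice.Build R (ell1 R)
  ple_refl ple_anti ple_trans meetP joinP leD2r leZ nrm_mono.

Lemma ell1_norm_fin x : ell1_norm x = `|x|%:E.
Proof. by rewrite ell1_normE nrmE. Qed.

End Ell1Lattice.

Section FBL.
Context {R : realType} {E : normedModType R}.
Implicit Types (f g : dual E -> R) (u : dual E).

Definition pos_homogeneous f : Prop :=
  forall (a : R) u, 0 <= a -> f (a *: u) = a * f u.

(* Finite families u_1, ..., u_n in E^* with sup_(|x| <= 1) sum |u_k x| <= 1. *)
Definition admissible : set (seq (dual E)) :=
  [set s : seq (dual E) | (ereal_sup
    [set (\sum_(u <- s) `|u x|)%:E | x in [set x : E | (`|x| <= 1)%R]] <= 1)%E].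

Definition fbl_norm f : \bar R := supsum admissible f.
Arguments fbl_norm f%_R.

Definition delta (x : E) : dual E -> R := fun u => u x.

Definition function_sublattice (S : set (dual E -> R)) : Prop :=
  [/\ S 0, (forall (a : R) f g, S f -> S g -> S (a *: f + g)) &
      forall f g, S f -> S g -> S (f \min g) /\ S (f \max g)].

Definition fbl_generated : set (dual E -> R) :=
  smallest function_sublattice (range delta).

Definition fbl_pred : {pred dual E -> R} :=
  mem [set f | [/\ pos_homogeneous f, (fbl_norm f < +oo)%E &
    forall e : R, 0 < e ->
      exists2 g, fbl_generated g & (fbl_norm (f - g) < e%:E)%E]].

Lemma admissible_nil : admissible [::].
Proof.
by apply: ge_ereal_sup => _ [x _ <-]; rewrite big_nil lee_fin.
Qed.

Lemma fbl_generated_sublattice : function_sublattice fbl_generated.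
Proof.
split.
- by move=> A [[A0 _ _] _].
- by move=> a f g Sf Sg A Ah; have [[_ AD _] _] := Ah; apply: AD; [exact: Sf|exact: Sg].
- by move=> f g Sf Sg; split=> A Ah; have [[_ _ AL] _] := Ah;
    have [] := AL f g (Sf A Ah) (Sg A Ah).
Qed.

Lemma pos_homogeneousD (a : R) f g :
  pos_homogeneous f -> pos_homogeneous g -> pos_homogeneous (a *: f + g).
Proof.
move=> hf hg b u b0; change (a * f (b *: u) + g (b *: u) = b * (a * f u + g u)).
by rewrite hf// hg// mulrDr mulrCA.
Qed.

Lemma pos_homogeneous_lattice f g : pos_homogeneous f -> pos_homogeneous g ->
  pos_homogeneous (f \min g) /\ pos_homogeneous (f \max g).
Proof.
by move=> hf hg; split=> b u b0 /=; rewrite hf// hg// ?minr_pMr ?maxr_pMr.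
Qed.

Lemma fbl_submod_closed : submod_closed fbl_pred.
Proof.
have [S0 SD _] := fbl_generated_sublattice.
split.
  rewrite inE/=; split; first by move=> a u _; rewrite mulr0.
    by rewrite /fbl_norm supsum0 ?ltry//; exact: admissible_nil.
  by move=> e e0; exists 0 => //; rewrite subr0 /fbl_norm supsum0//; exact: admissible_nil.
move=> a f g; rewrite !inE/= => -[hf ff cf] [hg fg cg].
split; first exact: pos_homogeneousD.
  apply: le_lt_trans (supsumD _ _ _) _; apply: lte_add_pinfty => //.
  rewrite supsumZ; last exact: admissible_nil.
  by apply: lte_mul_pinfty => //; rewrite lee_fin.
move=> e e0; have e20 : 0 < e / 2 by rewrite divr_gt0.
have a0 : 0 < `|a| + 1 by rewrite ltr_wpDl.
have [f' Sf' ff'] := cf _ (divr_gt0 e20 a0); have [g' Sg' gg'] := cg _ e20.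
exists (a *: f' + g'); first exact: SD.
rewrite opprD addrACA -scalerBr; apply: le_lt_trans (supsumD _ _ _) _.
rewrite [ltRHS](_ : _ = (e / 2)%:E + (e / 2)%:E)%E; last by rewrite -EFinD -splitr.
apply: lteD => //; rewrite supsumZ; last exact: admissible_nil.
apply: (@le_lt_trans _ _ (`|a|%:E * (e / 2 / (`|a| + 1))%:E)%E).
  by rewrite lee_wpmul2l ?lee_fin//; exact: ltW.
rewrite -EFinM lte_fin mulrCA gtr_pMr//.
by rewrite ltr_pdivrMr// mul1r ltrDl.
Qed.

HB.instance Definition _ :=
  GRing.isSubmodClosed.Build R (dual E -> R) fbl_pred fbl_submod_closed.

End FBL.
Arguments fbl_norm {R E} f%_R.

Record FBL (R : realType) (E : normedModType R) : Type :=
  Fbl { fbl_fun :> dual E -> R; fblP : fbl_fun \in fbl_pred }.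

HB.instance Definition _ R E := [isSub for @fbl_fun R E].
HB.instance Definition _ R E := [Choice of @FBL R E by <:].
HB.instance Definition _ R E := [SubChoice_isSubLmodule of @FBL R E by <:].

Section FBLLattice.
Context {R : realType} {E : normedModType R}.
Implicit Types x y z : FBL E.

Let F : set (seq (dual E)) := admissible.
Let F0 : F [::]. Proof. exact: admissible_nil. Qed.

Let nrm x : R := fine (fbl_norm x).

Let nrmE x : supsum F x = (nrm x)%:E.
Proof.
rewrite /nrm fineK// ge0_fin_numE ?supsum_ge0//.
by have := fblP x; rewrite inE => -[].
Qed.

(* If |u x| <= c |x| with c > 0, then [:: c^-1 *: u] is admissible. *)
Let pointwise_bound (u : dual E) : exists2 c : R, 0 < c & forall f,
  pos_homogeneous f -> ((`|f u|)%:E <= c%:E * supsum F f)%E.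
Proof.
have /set_mem [lu cu] := dualP u.
pose U : {linear E -> R} := HB.pack (dual_fun u) (GRing.isLinear.Build R E R *%R (dual_fun u) lu).
have /linear_boundedP : bounded_near U (nbhs 0) by exact/linear_bounded_continuous.
move=> /pinfty_ex_gt0[c c0 uc]; exists c => // f hf.
have cV : 0 < c^-1 by rewrite invr_gt0.
have Fu : F [:: c^-1 *: u].
  apply: ge_ereal_sup => _ [x /= x1 <-]; rewrite big_seq1 lee_fin dualZE normrM gtr0_norm//.
  by rewrite mulrC ler_pdivrMr// mul1r; apply: le_trans (uc x) _; rewrite ler_piMr// ltW.
have := supsum_ubound f Fu; rewrite big_seq1 hf ?(ltW cV)// normrM (gtr0_norm cV) => h.
apply: (@le_trans _ _ (c%:E * (c^-1 * `|f u|)%:E)%E).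
  by rewrite -EFinM mulrA divff ?gt_eqF// mul1r.
by rewrite lee_wpmul2l// lee_fin ltW.
Qed.

Let coord_le u : exists2 c : R, 0 < c & forall x, `|x u| <= c * nrm x.
Proof.
have [c c0 h] := pointwise_bound u; exists c => // x.
by rewrite -lee_fin EFinM -nrmE; apply: h; have := fblP x; rewrite inE => -[].
Qed.

Let nrmD x y : nrm (x + y) <= nrm x + nrm y.
Proof. by rewrite -lee_fin EFinD -!nrmE; exact: supsumD. Qed.

Let nrmZ a x : nrm (a *: x) = `|a| * nrm x.
Proof. by apply: EFin_inj; rewrite EFinM -!nrmE -supsumZ. Qed.

Let nrm0 x : nrm x = 0 -> x = 0.
Proof.
move=> x0; apply/val_inj/funext => u /=; apply/eqP; rewrite -normr_le0.
by have [c _ /(_ x)] := coord_le u; rewrite x0 mulr0.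
Qed.

HB.instance Definition _ := Lmodule_isNormed.Build R (FBL E) nrmD nrmZ nrm0.

Let cplt (G : set_system (FBL E)) : ProperFilter G -> cauchy G -> cvg G.
Proof.
move=> GP; apply: (@supsum_complete _ _ F _ (@fbl_fun R E)) => //.
move=> f flim fcl; suff fP : f \in fbl_pred by exists (Fbl fP).
rewrite inE/=; split.
- move=> a u a0; apply: (cvg_unique _ (flim (a *: u))) => //.
  have := cvgZr (k := a) (flim u).
  rewrite (_ : (fun x : FBL E => x (a *: u)) = (fun x : FBL E => a * x u)).
    by apply.
  by apply/funext => x; have := fblP x; rewrite inE => -[/(_ a u a0)].
- have [x fx] := fcl 1 ltr01; rewrite -(subrK (fbl_fun x) f).
  apply: le_lt_trans (supsumD _ _ _) _; apply: lte_add_pinfty.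
    by apply: le_lt_trans fx _; rewrite ltry.
  by have -> := nrmE x; rewrite ltry.
- move=> e e0; have e20 : 0 < e / 2 by rewrite divr_gt0.
  have [x fx] := fcl _ e20.
  have := fblP x; rewrite inE => -[_ _ /(_ _ e20)[g Sg xg]].
  exists g => //; rewrite -(subrKA (fbl_fun x) f).
  apply: le_lt_trans (supsumD _ _ _) _.
  rewrite [ltRHS](_ : _ = (e / 2)%:E + (e / 2)%:E)%E; last by rewrite -EFinD -splitr.
  apply: lee_ltD => //; rewrite ge0_fin_numE ?supsum_ge0//.
  by apply: le_lt_trans fx _; rewrite ltry.
Qed.

HB.instance Definition _ := Uniform_isComplete.Build (FBL E) cplt.

Let lat x y : ((x : dual E -> R) \min (y : dual E -> R)) \in fbl_pred /\
  ((x : dual E -> R) \max (y : dual E -> R)) \in fbl_pred.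
Proof.
have [_ _ SL] := @fbl_generated_sublattice R E.
have := fblP x; have := fblP y; rewrite !inE/= => -[hy fy cy] [hx fx cx].
have [hm hM] := pos_homogeneous_lattice hx hy.
have cl (e : R) : 0 < e -> exists a b, [/\ fbl_generated a, fbl_generated b &
    (fbl_norm (fbl_fun x - a) + fbl_norm (fbl_fun y - b) < e%:E)%E].
  move=> e0; have e20 : 0 < e / 2 by rewrite divr_gt0.
  have [a Sa xa] := cx _ e20; have [b Sb yb] := cy _ e20.
  exists a, b; split => //.
  rewrite [ltRHS](_ : _ = (e / 2)%:E + (e / 2)%:E)%E; last by rewrite -EFinD -splitr.
  exact: lteD.
have xyoo : (supsum F x + supsum F y < +oo)%E by rewrite !nrmE -EFinD ltry.
have [nM nm] := supsum_lattice F x 0 y 0.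
rewrite !subr0 in nm nM.
have M0 : ((0 : dual E -> R) \max 0) = 0 by apply/funext => n /=; rewrite maxxx.
have m0 : ((0 : dual E -> R) \min 0) = 0 by apply/funext => n /=; rewrite minxx.
rewrite M0 subr0 in nM; rewrite m0 subr0 in nm.
split; split => //.
- exact: le_lt_trans xyoo.
- move=> e /cl[a [b [Sa Sb abe]]]; exists (a \min b); first by have [] := SL _ _ Sa Sb.
  by apply: le_lt_trans abe; have [] := supsum_lattice F x a y b.
- exact: le_lt_trans xyoo.
- move=> e /cl[a [b [Sa Sb abe]]]; exists (a \max b); first by have [] := SL _ _ Sa Sb.
  by apply: le_lt_trans abe; have [] := supsum_lattice F x a y b.
Qed.

Definition fbl_le x y : Prop := forall u, x u <= y u.
Definition fbl_meet x y : FBL E := Fbl (lat x y).1.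
Definition fbl_join x y : FBL E := Fbl (lat x y).2.

Let ple_refl x : fbl_le x x. Proof. by move=> n. Qed.

Let ple_anti x y : fbl_le x y -> fbl_le y x -> x = y.
Proof. by move=> xy yx; apply/val_inj/funext => n; apply/le_anti; rewrite xy yx. Qed.

Let ple_trans y x z : fbl_le x y -> fbl_le y z -> fbl_le x z.
Proof. by move=> xy yz n; exact: le_trans (xy n) (yz n). Qed.

Let meetP x y z : fbl_le z (fbl_meet x y) <-> fbl_le z x /\ fbl_le z y.
Proof.
split=> [h|[h k] n]; last by rewrite /= le_min h k.
by split=> n; have := h n; rewrite /= le_min => /andP[].
Qed.

Let joinP x y z : fbl_le (fbl_join x y) z <-> fbl_le x z /\ fbl_le y z.
Proof.
split=> [h|[h k] n]; last by rewrite /= ge_max h k.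
by split=> n; have := h n; rewrite /= ge_max => /andP[].
Qed.

Let leD2r z x y : fbl_le x y -> fbl_le (x + z) (y + z).
Proof. by move=> xy n; exact: lerD (xy n) (lexx _). Qed.

Let leZ (a : R) x y : 0 <= a -> fbl_le x y -> fbl_le (a *: x) (a *: y).
Proof. by move=> a0 xy n; exact: (ler_wpM2l a0 (xy n)). Qed.

Let nrm_mono x y : fbl_le (fbl_join x (- x)) (fbl_join y (- y)) -> `|x| <= `|y|.
Proof.
move=> xy; change (nrm x <= nrm y); rewrite -lee_fin -!nrmE.
by apply: supsum_monotone => n; have := xy n; rewrite /= !maxrN.
Qed.

HB.instance Definition _ := isBanachLattice.Build R (FBL E)
  ple_refl ple_anti ple_trans meetP joinP leD2r leZ nrm_mono.

Lemma fbl_norm_fin x : fbl_norm x = `|x|%:E.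
Proof. exact: nrmE. Qed.

End FBLLattice.

(* Main.v *)
(* All conditions are compared with a lower estimate (L): FBL[E] contains a bounded     *)
(* sequence f_k such that every upper bound of the t_k f_k (t_k >= 0) has norm at least *)
(* c * sum_k t_k.                                                                       *)
(* Disjoint positive copies of the unit vectors of l1 satisfy (L). If l1 is only        *)
(* linearly complemented in FBL[E], with biorthogonal functionals phi_k, then phi_k     *)
(* tends to 0 uniformly on order intervals, and (L) holds for a subsequence of |f_k|.   *)
(* Conversely, given (L), the Hahn-Banach theorem gives positive functionals psi_k on   *)
(* FBL[E], of bounded sum, with psi_k f_k >= 1. Approximating f_k by a difference of    *)
(* maxima of evaluations delta_a and splitting psi_k over the a, one obtains            *)
(* functionals v |-> psi_(k,a) (delta_v) on E; as the norms of the f_k are bounded,     *)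
(* signed sums of these over a give a weakly unconditionally Cauchy sequence in the     *)
(* dual of E which is bounded away from 0, hence a complemented copy of l1 in E by      *)
(* Rosenthal's disjointification lemma.                                                 *)
(* The remaining implications are functoriality of FBL, evaluation of FBL[l1] at the    *)
(* coordinate functionals, and the fact that a lattice quotient map of FBL[E] onto l1   *)
(* splits.                                                                              *)
Require Import Defs.
From HB Require Import structures.
From mathcomp Require Import all_boot all_order all_algebra.
From mathcomp Require Import boolp classical_sets functions reals.
From mathcomp Require Import constructive_ereal ereal topology tvs normedtype sequences.
From mathcomp Require Import lra.

Set Implicit Arguments.
Unset Strict Implicit.
Unset Printing Implicit Defensive.

Import Order.TTheory GRing.Theory Num.Theory.
Import numFieldNormedType.Exports.

Local Open Scope classical_set_scope.
Local Open Scope ring_scope.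

(** * Complemented copies as retracts *)

(** The estimate (L), encoded as [sup_lower_l1], is the pivot: (5) and (6) both imply it, and it
    implies (1). [lattice_ell1_sup_lower] reads it off a sublattice copy of l1;
    [complemented_sup_lower] extracts it from a merely linear complemented copy, where
    [wuc_order_interval] and [wuc_diagonal] make up for the missing order structure.

    The estimate descends to E in [sup_lower_l1_complemented] because the norm of FBL[E] tests an
    element only on admissible families of functionals on E. If an element of bounded norm sums to
    at least 1 over a finite family, then that family is large at some vector of the unit ball of E.
    Such families come from [hahn_banach], and [wuc_retract] turns them into a complemented copy of
    l1.

    Upwards, everything is a factorization of an identity map: [fbl_map_retract] carries one from E
    to FBL[E], and [hom_section] builds one from any lattice homomorphism of FBL[E] onto l1, so that
    (4) yields (3), (5) and (6). *)

Section BoundedLinear.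
Context {R : realType}.
Implicit Types X Y : normedModType R.

Lemma continuous_linearP X Y (T : {linear X -> Y}) :
  continuous T <-> exists2 C : R, 0 < C & forall x, `|T x| <= C * `|x|.
Proof.
rewrite -linear_bounded_continuous linear_boundedP; split.
  by move=> /pinfty_ex_gt0[C C0 TC]; exists C.
move=> [C C0 TC]; exists C; split; first exact: num_real.
by move=> r Cr x; apply: le_trans (TC x) _; rewrite ler_wpM2r// ltW.
Qed.

Lemma mk_linear (U V : lmodType R) (f : U -> V) :
  linear f -> exists T : {linear U -> V}, forall x, T x = f x.
Proof.
move=> lf.
by exists (HB.pack f (GRing.isLinear.Build R U V *:%R f lf) : {linear U -> V}).
Qed.

Lemma iso_onto_bounded_below X Y (T : {linear X -> Y}) (S : set Y) :
  iso_onto T S -> exists2 C : R, 0 < C & forall x, `|x| <= C * `|T x|.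
Proof.
move=> [_ TS [U [cU TU]]].
have S0 : S 0 by rewrite -TS; exists 0 => //; rewrite linear0.
have U0 : U 0 = 0 by rewrite -(linear0 T) TU.
have /cvgrPdist_le/(_ 1 ltr01) := (@subspace_continuousP _ S _ U).1 cU _ S0.
rewrite U0 => /(@nbhs_norm0P R Y)[e' /= e'0 He].
have [e e0 {}He] : exists2 e : R, 0 < e & forall x, `|T x| <= e -> `|x| <= 1.
  exists (e' / 2 : R) => [|x xe]; first by rewrite divr_gt0.
  have := He (T x); rewrite sub0r normrN TU; apply; last by rewrite -TS; exists x.
  by apply: le_lt_trans xe _; rewrite ltr_pdivrMr// ltr_pMr// ltr1n.
exists e^-1 => [|x]; first by rewrite invr_gt0.
have [->|x0] := eqVneq x 0; first by rewrite normr0 linear0 normr0 mulr0.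
have Tx0 : 0 < `|T x|.
  rewrite normr_gt0; apply/eqP => Tx; move/eqP: x0; apply.
  by rewrite -(TU x) Tx U0.
have a0 : 0 < e / `|T x| by rewrite divr_gt0.
have := He (e / `|T x| *: x); rewrite linearZ/= (normrZ _ x) (normrZ _ (T x)).
rewrite (gtr0_norm a0) divfK ?gt_eqF// => /(_ (lexx _)).
by rewrite -ler_pdivlMl// mulr1 invf_div mulrC.
Qed.

(** The inverse in [iso_onto] is a bare function, continuous only within [S]. Composed with the
    projection it becomes linear because [T] is injective, and bounded because [T] is bounded below.
    Conversely, [T \o Q] is a projection onto [range T]. *)
Lemma complemented_retractP X Y :
  contains_complemented X Y <->
  exists (T : {linear X -> Y}) (Q : {linear Y -> X}),
    [/\ continuous T, continuous Q & cancel T Q].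
Proof.
split=> [[S [_ [P [cP PP PS]] [T TS]]]|[T [Q [cT cQ TQ]]]].
  have [C C0 TC] := iso_onto_bounded_below TS.
  have [cT rT [U [_ TU]]] := TS.
  have PT y : T (U (P y)) = P y.
    have : S (P y) by rewrite -PS; exists y.
    by rewrite -rT => -[x _ <-]; rewrite TU.
  have PTid x : P (T x) = T x.
    have : S (T x) by rewrite -rT; exists x.
    by rewrite -PS => -[y _ <-].
  have lQ : linear (U \o P).
    by move=> a x y; apply: (can_inj TU); rewrite linearP/= !PT linearP.
  have [Q QE] := mk_linear lQ.
  exists T, Q; split => // [|x]; last by rewrite QE/= PTid TU.
  have [D D0 PD] := (continuous_linearP P).1 cP.
  apply/continuous_linearP; exists (C * D); first exact: mulr_gt0.
  move=> y; rewrite QE/=; apply: le_trans (TC _) _; rewrite PT -mulrA.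
  by rewrite ler_wpM2l// ltW.
exists (range T); split.
- split; first by exists 0 => //; rewrite linear0.
  by move=> a _ _ [x _ <-] [y _ <-]; exists (a *: x + y) => //; rewrite linearP.
- exists (T \o Q : {linear Y -> Y}); split.
  + by move=> y; apply: continuous_comp; [exact: cQ|exact: cT].
  + by move=> y /=; rewrite TQ.
  + apply/seteqP; split=> [_ [y _ <-]|_ [x _ <-]]; first by exists (Q y).
    by exists (T x) => //=; rewrite TQ.
- exists T; split => //; exists Q; split => //.
  exact: continuous_subspaceT.
Qed.

End BoundedLinear.

Section LatticeRetract.
Context {R : realType}.
Implicit Types X Y : banachLatticeType R.

Lemma lattice_retract X Y (T : {linear X -> Y}) (Q : {linear Y -> X}) :
  lattice_hom T -> lattice_hom Q -> continuous T -> continuous Q -> cancel T Q ->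
  [/\ is_sublattice (range T), lattice_complemented (range T),
      lattice_isomorphic X (range T) & closed (range T)].
Proof.
move=> [Tm Tj] [Qm Qj] cT cQ TQ; split.
- split; first split; first by exists 0 => //; rewrite linear0.
    by move=> a _ _ [x _ <-] [y _ <-]; exists (a *: x + y) => //; rewrite linearP.
  by move=> _ _ [x _ <-] [y _ <-]; split; [exists (vmeet x y)|exists (vjoin x y)].
- exists (T \o Q : {linear Y -> Y}); split.
  + by split=> x y /=; rewrite ?Qm ?Qj.
  + by move=> y /=; rewrite TQ.
  + apply/seteqP; split=> [_ [y _ <-]|_ [x _ <-]]; first by exists (Q y).
    by exists (T x) => //=; rewrite TQ.
- exists T; split => //; split => //; exists Q; split => //.
  exact: continuous_subspaceT.
- rewrite (_ : range T = (fun y => T (Q y) - y) @^-1` [set 0]).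
    apply: preimage_closed => [y _|]; last first.
      apply: accessible_closed_set1; apply: hausdorff_accessible.
      exact: norm_hausdorff.
    apply: (@cvgB _ _ _ (nbhs y) _ (T \o Q) id); last exact: cvg_id.
    by apply: continuous_comp; [exact: cQ|exact: cT].
  apply/seteqP; split=> [_ [x _ <-]|y /= /eqP]; first by rewrite /= TQ subrr.
  by rewrite subr_eq0 => /eqP yE; exists (Q y).
Qed.

(** The projection in [lattice_complemented] is purely algebraic, so [Q] is obtained without
    continuity; once the target is l1, [hom_continuous] supplies it. *)
Lemma lattice_complemented_onto X Y (S : set Y) :
  lattice_complemented S -> lattice_isomorphic X S ->
  exists Q : {linear Y -> X}, lattice_hom Q /\ range Q = setT.
Proof.
move=> [P [[Pm Pj] PP PS]] [T [[Tm Tj] [cT rT [U [_ TU]]]]].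
have PT y : T (U (P y)) = P y.
  have : S (P y) by rewrite -PS; exists y.
  by rewrite -rT => -[x _ <-]; rewrite TU.
have PTid x : P (T x) = T x.
  have : S (T x) by rewrite -rT; exists x.
  by rewrite -PS => -[y _ <-].
have lQ : linear (U \o P).
  by move=> a x y; apply: (can_inj TU); rewrite linearP/= !PT linearP.
have [Q QE] := mk_linear lQ.
exists Q; split; first by split=> x y; rewrite !QE/=; apply: (can_inj TU);
  rewrite ?Tm ?Tj !PT ?Pm ?Pj.
by apply/seteqP; split=> // x _; exists (T x) => //; rewrite QE/= PTid TU.
Qed.

End LatticeRetract.

(** * Sums indexed by l1 *)

Section Ell1Tools.
Context {R : realType}.
Implicit Types (x y : ell1 R) (a : nat -> R).

Lemma ell1_norm_sum_le a (C : R) :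
  (forall N, \sum_(0 <= n < N) `|a n| <= C) -> (ell1_norm a <= C%:E)%E.
Proof.
by move=> aC; rewrite ell1_normE; apply: supsum_le => _ [N _ <-]; rewrite lee_fin.
Qed.

Lemma ell1_mem a (C : R) :
  (forall N, \sum_(0 <= n < N) `|a n| <= C) -> a \in ell1_pred.
Proof. by move=> /ell1_norm_sum_le aC; rewrite inE/=; exact: le_lt_trans aC (ltry _). Qed.

Lemma ell1_norm_le x (C : R) :
  (forall N, \sum_(0 <= n < N) `|x n| <= C) -> `|x| <= C.
Proof. by move=> /ell1_norm_sum_le; rewrite ell1_norm_fin lee_fin. Qed.

Lemma ell1_partial_le x N : \sum_(0 <= n < N) `|x n| <= `|x|.
Proof.
by rewrite -lee_fin -ell1_norm_fin ell1_normE; apply: supsum_ubound; exists N.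
Qed.

Lemma ell1_coord_le x n : `|x n| <= `|x|.
Proof.
apply: le_trans (ell1_partial_le x n.+1).
by rewrite big_nat_recr//= lerDr sumr_ge0.
Qed.

Lemma ell1_finite_mem a m : (forall n, (m <= n)%N -> a n = 0) -> a \in ell1_pred.
Proof.
move=> a0; apply: (@ell1_mem _ (\sum_(0 <= n < m) `|a n|)) => N.
have [Nm|/ltnW mN] := leqP N m.
  by rewrite (@big_cat_nat _ _ _ N 0 m)//= lerDl sumr_ge0.
rewrite (@big_cat_nat _ _ _ m 0 N)//= [X in _ + X]big_nat_cond.
by rewrite [X in _ + X]big1 ?addr0// => n /andP[/andP[mn _] _]; rewrite a0// normr0.
Qed.

Lemma ell1_sumE (I : Type) (r : seq I) (F : I -> ell1 R) i :
  (\sum_(n <- r) F n) i = \sum_(n <- r) F n i.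
Proof. exact: (big_morph (fun x : ell1 R => x i) (fun _ _ => erefl) erefl). Qed.

Lemma ell1_trunc_mem a m : (fun n => if (n < m)%N then a n else 0) \in ell1_pred.
Proof. by apply: (@ell1_finite_mem _ m) => n mn; rewrite ltnNge mn. Qed.

Definition ell1_trunc a m : ell1 R := Ell1 (ell1_trunc_mem a m).

Definition ell1_basis i : ell1 R := ell1_trunc (fun n => (n == i)%:R) i.+1.

Lemma ell1_basisE i n : ell1_basis i n = (n == i)%:R.
Proof. by rewrite /=; case: ltnP => // /gtn_eqF ->. Qed.

Definition geom (n : nat) : R := 2^-1 ^+ n.

Lemma geom_gt0 n : 0 < geom n.
Proof. by rewrite exprn_gt0// invr_gt0. Qed.

Lemma geom_sum m N : \sum_(m <= n < N) geom n <= 2 * geom m.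
Proof.
suff H : \sum_(m <= n < m + (N - m)) geom n = 2 * geom m - 2 * geom (m + (N - m)).
  have [Nm|mN] := leqP N m.
    by rewrite big_geq// mulr_ge0// ltW// geom_gt0.
  by move: H; rewrite subnKC ?(ltnW mN)// => ->; rewrite gerBl mulr_ge0// ltW// geom_gt0.
elim: (N - m)%N => [|k IH]; first by rewrite addn0 big_geq// subrr.
rewrite addnS big_nat_recr ?leq_addr//= IH /geom exprS; lra.
Qed.

Lemma ell1_geom_mem : geom \in ell1_pred.
Proof.
apply: (@ell1_mem _ (2 * geom 0)) => N; apply: le_trans (geom_sum 0 N).
by apply: ler_sum => n _; rewrite gtr0_norm// geom_gt0.
Qed.

Definition ell1_geom : ell1 R := Ell1 ell1_geom_mem.

Lemma cvg_sum_single (V : normedModType R) (c : nat -> V) i :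
  (forall n, n != i -> c n = 0) ->
  \sum_(0 <= n < N) c n @[N --> \oo] --> c i.
Proof.
move=> c0; apply: cvg_near_cst; exists i.+1 => // N /= iN.
rewrite (@big_cat_nat _ _ _ i.+1)//= big_nat_recr//= big_nat_cond big1 ?add0r.
  rewrite big_nat_cond big1 ?addr0// => n /andP[/andP[ni _] _].
  by rewrite c0// gtn_eqF.
by move=> n /andP[/andP[_ ni] _]; rewrite c0// ltn_eqF.
Qed.

(** The universal property of l1, by absolute convergence. The convergence of partial sums is kept
    in the conclusion because values of [A] are later computed by passing continuous maps through
    the series. *)
Lemma ell1_sum (Y : completeNormedModType R) (u : nat -> Y) (C : R) :
  (forall n, `|u n| <= C) ->
  exists A : {linear ell1 R -> Y}, [/\ forall x, `|A x| <= C * `|x|,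
    forall x, \sum_(0 <= n < N) x n *: u n @[N --> \oo] --> A x &
    forall i, A (ell1_basis i) = u i].
Proof.
move=> uC; have C0 : 0 <= C by apply: le_trans (uC 0%N).
have part x N : \sum_(0 <= n < N) `|x n *: u n| <= C * `|x|.
  apply: (@le_trans _ _ (C * \sum_(0 <= n < N) `|x n|)).
    by rewrite mulr_sumr; apply: ler_sum => n _; rewrite normrZ mulrC ler_wpM2r.
  by rewrite ler_wpM2l// ell1_partial_le.
have cv x : cvgn (series (fun n => x n *: u n)).
  apply: normed_cvg; apply: nondecreasing_is_cvgn.
    by apply: nondecreasing_series => n _ _; exact: normr_ge0.
  by exists (C * `|x|) => _ [N _ <-]; exact: part.
pose f x := limn (series (fun n => x n *: u n)).
have lf : linear f.
  move=> a x y; rewrite /f; apply/cvg_lim => //.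
  have -> : series (fun n => (a *: x + y) n *: u n) =
      a *: series (fun n => x n *: u n) + series (fun n => y n *: u n).
    apply/funext => N; rewrite /series !fctE/= scaler_sumr -big_split/=.
    by apply: eq_bigr => n _; rewrite scalerA -scalerDl.
  by apply: cvgD; [apply: cvgZl_tmp|]; exact: cv.
have [A AE] := mk_linear lf.
exists A; split=> [x|x|i]; rewrite AE; last 1 first.
- apply/cvg_lim => //; rewrite (_ : u i = ell1_basis i i *: u i); last first.
    by rewrite ell1_basisE eqxx scale1r.
  by apply: cvg_sum_single => n /negbTE ni; rewrite ell1_basisE ni scale0r.
- apply: (ler_cvg_to (cvg_norm (cv x)) (cvg_cst (C * `|x|))); apply: nearW => N.
  by apply: le_trans (ler_norm_sum _ _ _) (part x N).
- exact: cv.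
Qed.

Lemma ell1_coord_continuous i : continuous (fun x : ell1 R => x i).
Proof.
have lc : linear (fun x : ell1 R => x i : R^o) by [].
have [T TE] := mk_linear lc.
have cT : continuous T.
  by apply/continuous_linearP; exists 1 => // x; rewrite TE mul1r ell1_coord_le.
by have -> : (fun x : ell1 R => x i) = T by apply/funext => x; rewrite TE.
Qed.

End Ell1Tools.

(** * The norm and the functoriality of FBL *)

Section FBLTools.
Context {R : realType}.

Section Dual.
Context {E : normedModType R}.
Implicit Types u : dual E.

Lemma dual_linear u a x y : u (a *: x + y) = a * u x + u y.
Proof. by have /set_mem[/= lu _] := dualP u; exact: lu. Qed.

Lemma dual0 u : u 0 = 0.
Proof. by have := dual_linear u 1 0 0; rewrite scaler0 addr0 mul1r; lra. Qed.

Lemma dualZ u a x : u (a *: x) = a * u x.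
Proof. by rewrite -[a *: x]addr0 dual_linear dual0 addr0. Qed.

Lemma dual_bounded u : exists2 c : R, 0 < c & forall x, `|u x| <= c * `|x|.
Proof.
have /set_mem[/= lu cu] := dualP u.
have [U UE] := @mk_linear R E R^o u lu.
have cU : continuous U by have -> : U = u :> (E -> R) by apply/funext => x; rewrite UE.
have [c c0 h] := (continuous_linearP U).1 cU.
by exists c => // x; rewrite -UE.
Qed.

Lemma mk_dual (f : E -> R) (c : R) : 0 < c -> linear (f : E -> R^o) ->
  (forall x, `|f x| <= c * `|x|) -> exists u : dual E, forall x, u x = f x.
Proof.
move=> c0 lf fc; have [T TE] := @mk_linear R E R^o f lf.
have fP : f \in @dual_pred R E.
  apply/mem_set; split => //.
  have -> : f = T by apply/funext => x; rewrite TE.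
  by apply/continuous_linearP; exists c => // x; rewrite TE.
by exists (Dual fP).
Qed.

Lemma admissibleP (s : seq (dual E)) :
  admissible s <-> forall x, \sum_(u <- s) `|u x| <= `|x|.
Proof.
split=> [sa x|sx]; last first.
  apply: ge_ereal_sup => _ [x /= x1 <-]; rewrite lee_fin.
  exact: le_trans (sx x) x1.
have [->|x0] := eqVneq x 0.
  by rewrite normr0 big1// => u _; rewrite dual0 normr0.
have nx : 0 < `|x| by rewrite normr_gt0.
have : ((\sum_(u <- s) `|u (`|x|^-1 *: x)|)%:E <= 1)%E.
  apply: le_trans sa; apply: ereal_sup_ubound; exists (`|x|^-1 *: x) => //=.
  by rewrite normrZ normfV normr_id mulVf ?gt_eqF.
rewrite lee_fin; under eq_bigr do rewrite dualZ normrM normfV normr_id.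
by rewrite -mulr_sumr ler_pdivrMl// mulr1.
Qed.

Lemma fbl_pos_homogeneous (f : FBL E) : pos_homogeneous f.
Proof. by have := fblP f; rewrite inE => -[]. Qed.

Lemma fbl_sum_le (s : seq (dual E)) (C : R) : 0 < C ->
  (forall x, \sum_(u <- s) `|u x| <= C * `|x|) ->
  forall f : FBL E, \sum_(u <- s) `|f u| <= C * `|f|.
Proof.
move=> C0 sC f.
have CV : 0 < C^-1 by rewrite invr_gt0.
have : admissible [seq C^-1 *: u | u <- s].
  apply/admissibleP => x; rewrite big_map.
  under eq_bigr do rewrite dualZE normrM (gtr0_norm CV).
  by rewrite -mulr_sumr ler_pdivrMl.
move=> /(supsum_ubound f); rewrite -/(fbl_norm f) fbl_norm_fin lee_fin big_map.
under eq_bigr do rewrite fbl_pos_homogeneous ?(ltW CV)// normrM (gtr0_norm CV).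
by rewrite -mulr_sumr ler_pdivrMl.
Qed.

Lemma fbl_norm_le (f : FBL E) (C : R) :
  (forall s : seq (dual E), (forall x, \sum_(u <- s) `|u x| <= `|x|) ->
    \sum_(u <- s) `|f u| <= C) -> `|f| <= C.
Proof.
move=> fC; rewrite -lee_fin -fbl_norm_fin; apply: supsum_le => s /admissibleP sa.
by rewrite lee_fin; exact: fC.
Qed.

Lemma fbl_norm_mono (f g : FBL E) : (forall u, `|f u| <= `|g u|) -> `|f| <= `|g|.
Proof.
by move=> fg; rewrite -lee_fin -!fbl_norm_fin; exact: supsum_monotone.
Qed.

Lemma fbl_eval_continuous u : continuous (fun f : FBL E => f u).
Proof.
have lc : linear (fun f : FBL E => f u : R^o) by [].
have [T TE] := mk_linear lc.
have cT : continuous T.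
  apply/continuous_linearP; have [c c0 uc] := dual_bounded u.
  exists c => // f; rewrite TE.
  have := @fbl_sum_le [:: u] c c0 _ f; rewrite big_seq1; apply=> x.
  by rewrite big_seq1.
by have -> : (fun f : FBL E => f u) = T by apply/funext => x; rewrite TE.
Qed.

Lemma fbl_sumE (I : Type) (r : seq I) (F : I -> FBL E) u :
  (\sum_(n <- r) F n) u = \sum_(n <- r) F n u.
Proof. exact: (big_morph (fun x : FBL E => x u) (fun _ _ => erefl) erefl). Qed.

Lemma fbl_ext (f g : FBL E) : (forall u, f u = g u) -> f = g.
Proof. by move=> fg; apply/val_inj/funext. Qed.

Lemma delta_mem (x : E) : delta x \in fbl_pred.
Proof.
rewrite inE; split=> //.
- apply: le_lt_trans (ltry `|x|); apply: supsum_le => s /admissibleP sa.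
  by rewrite lee_fin; exact: sa.
- move=> e e0; exists (delta x); first by move=> A [_ sA]; apply: sA; exists x.
  by rewrite subrr /fbl_norm supsum0 ?lte_fin//; exact: admissible_nil.
Qed.

Definition fbl_delta (x : E) : FBL E := Fbl (delta_mem x).

Lemma fbl_delta_norm_le x : `|fbl_delta x| <= `|x|.
Proof. by apply: fbl_norm_le => s; apply. Qed.

End Dual.

Section Functor.
Context {E F : normedModType R} (A : {linear E -> F}) (cA : continuous A).

Lemma dual_comp_mem (u : dual F) : (u \o A) \in @dual_pred R E.
Proof.
have /set_mem[/= lu cu] := dualP u.
apply/mem_set; split=> [a x y /=|x]; first by rewrite linearP lu.
by apply: continuous_comp; [exact: cA|exact: cu].
Qed.

Definition dual_comp u : dual E := Dual (dual_comp_mem u).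

Lemma fbl_map_bound : exists2 C : R, 0 < C & forall f : dual E -> R,
  pos_homogeneous f -> (fbl_norm (f \o dual_comp) <= C%:E * fbl_norm f)%E.
Proof.
have [C C0 AC] := (continuous_linearP A).1 cA; exists C => // f hf.
have CV : 0 < C^-1 by rewrite invr_gt0.
apply: supsum_le => s /admissibleP sa.
have : admissible [seq C^-1 *: dual_comp u | u <- s].
  apply/admissibleP => x; rewrite big_map.
  under eq_bigr do rewrite dualZE normrM (gtr0_norm CV).
  rewrite -mulr_sumr ler_pdivrMl//; exact: le_trans (sa _) (AC _).
move=> /(supsum_ubound f); rewrite big_map.
under eq_bigr do rewrite hf ?(ltW CV)// normrM (gtr0_norm CV).
rewrite -mulr_sumr -/(fbl_norm f) => h.
apply: le_trans (_ : (C%:E * (C^-1 * \sum_(u <- s) `|f (dual_comp u)|)%:E <= _)%E).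
  by rewrite -EFinM mulrA divff ?gt_eqF// mul1r.
by rewrite lee_wpmul2l// lee_fin ltW.
Qed.

(** Composition with the adjoint of [A] preserves the lattice operations and sends [delta x] to
    [delta (A x)], so it maps generated functions to generated functions; [fbl_map_bound] carries
    this to their limits. Positive homogeneity of the approximant is tracked because that bound is
    applied to [f - g]. *)
Lemma fbl_map_mem (f : FBL E) : ((f : dual E -> R) \o dual_comp) \in fbl_pred.
Proof.
have [C C0 HC] := fbl_map_bound.
have := fblP f; rewrite !inE => -[hf ff cf].
split.
- move=> a u a0 /=; rewrite -hf//; congr (fbl_fun f _).
  exact/val_inj/funext.
- by apply: le_lt_trans (HC _ hf) _; rewrite fbl_norm_fin -EFinM ltry.
- move=> e e0; have [g Sg fg] := cf _ (divr_gt0 e0 C0).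
  have [S0 SD SL] := @fbl_generated_sublattice R F.
  have hg : pos_homogeneous g /\ fbl_generated (g \o dual_comp).
    apply: (Sg [set g | pos_homogeneous g /\ fbl_generated (g \o dual_comp)]); split; first split.
    + by split; [move=> a u _; rewrite mulr0|exact: S0].
    + move=> a h k [hh Sh] [hk Sk]; split; first exact: pos_homogeneousD.
      exact: SD Sh Sk.
    + move=> h k [hh Sh] [hk Sk]; have [? ?] := SL _ _ Sh Sk.
      by have [? ?] := pos_homogeneous_lattice hh hk.
    + move=> _ [x _ <-]; split=> // B [_ dB]; apply: dB; exists (A x) => //.
  have [{}hg Shg] := hg.
  exists (g \o dual_comp) => //.
  have hfg : pos_homogeneous (fbl_fun f - g).
    by rewrite addrC -scaleN1r; exact: pos_homogeneousD.
  apply: le_lt_trans (HC _ hfg) _.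
  rewrite -lte_pdivlMl// -EFinM mulrC; exact: fg.
Qed.

Lemma fbl_map : exists T : {linear FBL E -> FBL F},
  [/\ lattice_hom T, continuous T & forall f u, T f u = f (dual_comp u)].
Proof.
pose T0 f := Fbl (fbl_map_mem f).
have lT : linear T0 by move=> a f g; apply: fbl_ext.
have [T TE] := mk_linear lT; exists T; split=> [||f u]; last by rewrite TE.
- by split=> f g; rewrite !TE; apply: fbl_ext.
- apply/continuous_linearP; have [C C0 HC] := fbl_map_bound.
  exists C => // f; rewrite TE -lee_fin EFinM -!fbl_norm_fin.
  by apply: HC; exact: fbl_pos_homogeneous.
Qed.

End Functor.

Lemma fbl_map_retract (E F : normedModType R) (A : {linear E -> F}) (B : {linear F -> E}) :
  continuous A -> continuous B -> cancel A B ->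
  exists (T : {linear FBL E -> FBL F}) (Q : {linear FBL F -> FBL E}),
    [/\ lattice_hom T, lattice_hom Q, continuous T, continuous Q & cancel T Q].
Proof.
move=> cA cB AB.
have [T [hT cT TE]] := fbl_map cA; have [Q [hQ cQ QE]] := fbl_map cB.
exists T, Q; split => // f; apply: fbl_ext => u; rewrite QE TE.
by congr (fbl_fun f _); apply/val_inj/funext => x /=; rewrite AB.
Qed.

(* The coordinate functionals of l1 form an admissible family, so evaluation at *)
(* them maps FBL(l1) into l1. *)
Lemma fbl_ell1_onto : exists T : {linear FBL (ell1 R) -> ell1 R},
  lattice_hom T /\ range T = setT.
Proof.
have cP n : ((fun x : ell1 R => x n) : ell1 R -> R) \in @dual_pred R (ell1 R).
  by apply/mem_set; split=> //; exact: ell1_coord_continuous.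
pose c n : dual (ell1 R) := Dual (cP n).
have Tmem (f : FBL (ell1 R)) : (fun n => f (c n)) \in ell1_pred.
  apply: (@ell1_mem _ _ (1 * `|f|)) => N.
  have := @fbl_sum_le _ (map c (index_iota 0 N)) 1 ltr01 _ f.
  by rewrite big_map; apply=> x; rewrite big_map mul1r; exact: ell1_partial_le.
pose T0 f : ell1 R := Ell1 (Tmem f).
have lT : linear T0 by move=> a f g; apply/val_inj/funext.
have [T TE] := mk_linear lT; exists T; split.
  by split=> f g; rewrite !TE; exact/val_inj/funext.
(* Evaluating [fbl_delta x] at the coordinate functionals gives back [x]. *)
apply/seteqP; split => // x _; exists (fbl_delta x) => //.
by rewrite TE; apply/val_inj/funext.
Qed.

End FBLTools.

(** * Lattice quotients onto l1 split *)

Section Quotient.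
Context {R : realType}.

(** Take [w] to be the sum of the 2^-n [u n]: all terms are nonnegative under [ev i], so each is
    below the sum. The maps [ev] describe the order: evaluations at functionals for FBL, coordinates
    for l1. *)
Lemma geom_dominate (Y : completeNormedModType R) (I : Type) (ev : I -> Y -> R) :
  (forall i, linear (ev i : Y -> R^o)) -> (forall i, continuous (ev i)) ->
  forall u : nat -> Y, (forall n, `|u n| <= 1) -> (forall n i, 0 <= ev i (u n)) ->
  exists w : Y, forall k i, geom k * ev i (u k) <= ev i w.
Proof.
move=> lev cev u u1 u0; have [A [_ Alim _]] := ell1_sum u1.
exists (A ell1_geom) => k i.
have [L LE] := mk_linear (lev i).
have lim := cvg_comp _ _ (Alim ell1_geom) (cev i (A ell1_geom)).
apply: (ler_cvg_to (cvg_cst (geom k * ev i (u k))) lim).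
exists k.+1 => // N /= kN; rewrite -!LE linear_sum/=.
under eq_bigr do rewrite linearZ/= LE.
rewrite (bigD1_seq k)/= ?iota_uniq ?mem_index_iota//= LE lerDl sumr_ge0// => n _.
by rewrite mulr_ge0// ltW// geom_gt0.
Qed.

Lemma unbounded_geom (x : R) : exists k, ~ ((geom k)^-1 <= x).
Proof.
exists (Num.bound x); apply/negP; rewrite -ltNge.
by rewrite /geom -exprVn invrK; exact: upper_nthrootP.
Qed.

Lemma ell1_sum_section (Y : normedModType R) (T : {linear Y -> ell1 R})
    (x : nat -> Y) (A : ell1 R -> Y) : continuous T ->
  (forall y : ell1 R, \sum_(0 <= n < N) y n *: x n @[N --> \oo] --> A y) ->
  (forall n, T (x n) = ell1_basis n) -> cancel A T.
Proof.
move=> cT Alim Tx y; apply/val_inj/funext => i /=.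
have lim := cvg_comp _ _ (cvg_comp _ _ (Alim y) (cT (A y)))
  (@ell1_coord_continuous R i (T (A y))).
apply: (cvg_unique _ lim) => //.
have lim2 : \sum_(0 <= n < N) y n * ell1_basis n i @[N --> \oo] -->
    y i * ell1_basis i i.
  apply: (@cvg_sum_single R R^o (fun n => y n * ell1_basis n i)) => n ni.
  by rewrite ell1_basisE eq_sym (negbTE ni) mulr0.
move: lim2; rewrite ell1_basisE eqxx mulr1.
apply: cvg_trans; apply: near_eq_cvg; apply: nearW => N /=.
rewrite linear_sum ell1_sumE; apply: eq_bigr => n _.
by rewrite linearZ Tx.
Qed.

Section Lift.
Context {E : normedModType R}.

Implicit Types f g : FBL E.

Definition fbl_abs (f : FBL E) : FBL E := vjoin f (- f).

Lemma fbl_absE f u : fbl_abs f u = `|f u|.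
Proof. by rewrite -maxrN. Qed.

Lemma fbl_abs_norm f : `|fbl_abs f| <= `|f|.
Proof. by apply: fbl_norm_mono => u; rewrite fbl_absE normr_id. Qed.

Context (T : {linear FBL E -> ell1 R}) (hT : lattice_hom T).

Lemma hom_joinE f g n : T (vjoin f g) n = Num.max (T f n) (T g n).
Proof. by rewrite hT.2. Qed.

Lemma hom_meetE f g n : T (vmeet f g) n = Num.min (T f n) (T g n).
Proof. by rewrite hT.1. Qed.

Lemma hom_absE f n : T (fbl_abs f) n = `|T f n|.
Proof. by rewrite hom_joinE linearN maxrN. Qed.

Lemma hom_mono f g : (forall u, f u <= g u) -> forall n, T f n <= T g n.
Proof.
move=> fg n; have gE : g = vjoin f g by apply: fbl_ext => u /=; apply/esym/max_idPr.
by rewrite gE hom_joinE le_max lexx.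
Qed.

(* Were [T] unbounded on the [f k], it would be so on the positive element *)
(* [w >= 2^-k |f k|]. *)
Lemma hom_continuous : continuous T.
Proof.
apply: contrapT => /continuous_linearP nT.
(* Growth 4^k is asked for so that 2^k remains after the factor 2^-k in [geom_dominate]. *)
have H k : {f : FBL E | `|f| <= 1 & (geom k)^-1 ^+ 2 <= `|T f|}.
  apply/cid2; apply: contrapT => nH; apply: nT.
  have g0 : 0 < (geom k)^-1 ^+ 2 :> R by rewrite exprn_gt0// invr_gt0 geom_gt0.
  exists ((geom k)^-1 ^+ 2) => // f; rewrite leNgt; apply/negP => fT; apply: nH.
  have f0 : 0 < `|f|.
    rewrite normr_gt0; apply/eqP => f0; move: fT.
    by rewrite f0 linear0 !normr0 mulr0 ltxx.
  exists (`|f|^-1 *: f); first by rewrite normrZ normfV normr_id mulVf ?gt_eqF.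
  by rewrite linearZ/= normrZ normfV normr_id mulrC ler_pdivlMr// ltW.
pose f k := s2val (H k).
have [w wP] := @geom_dominate (FBL E) (dual E) (fun u g => g u)
  (fun _ _ _ _ => erefl) (@fbl_eval_continuous R E) (fun k => fbl_abs (f k))
  (fun k => le_trans (fbl_abs_norm _) (s2valP (H k)))
  (fun k u => eq_ind_r (fun r => 0 <= r) (normr_ge0 _) (fbl_absE _ _)).
have [k] := unbounded_geom `|T w|; apply.
have gk : 0 < geom k :> R := geom_gt0 k.
have : geom k * `|T (f k)| <= `|T w|.
  rewrite -(gtr0_norm gk) -normrZ; apply: ell1_norm_le => N.
  apply: le_trans (ell1_partial_le _ N); apply: ler_sum => n _.
  have : geom k * T (fbl_abs (f k)) n <= T w n.
    by have := @hom_mono (geom k *: fbl_abs (f k)) w (wP k) n; rewrite linearZ.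
  rewrite hom_absE => h; apply: le_trans (ler_norm _).
  by apply: le_trans h; rewrite normrM gtr0_norm.
apply: le_trans; rewrite -ler_pdivrMl//; apply: le_trans (s2valP' (H k)).
by rewrite expr2.
Qed.

Hypothesis sT : range T = setT.

Lemma hom_positive_lift (x : ell1 R) : (forall n, 0 <= x n) ->
  exists2 f : FBL E, (forall u, 0 <= f u) & T f = x.
Proof.
move=> x0; have : range T x by rewrite sT.
move=> [f _ fx]; exists (fbl_abs f) => [u|]; first by rewrite fbl_absE.
by apply/val_inj/funext => n /=; rewrite hom_absE fx ger0_norm.
Qed.

Lemma ell1_basis_ge0 n i : 0 <= ell1_basis (R := R) n i.
Proof. by rewrite ell1_basisE. Qed.

Lemma ell1_basis_norm n : `|ell1_basis (R := R) n| <= 1.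
Proof.
apply: ell1_norm_le => N; under eq_bigr do rewrite ell1_basisE.
have [nN|Nn] := ltnP n N.
  rewrite (bigD1_seq n)/= ?iota_uniq ?mem_index_iota//= eqxx normr1.
  by rewrite big1 ?addr0// => i /negbTE ->; rewrite normr0.
rewrite big_nat_cond big1// => i /andP[/andP[_ iN] _].
by rewrite ltn_eqF ?normr0//; exact: leq_trans Nn.
Qed.

(* Suppose the positive lifts of [e_(n k)] have norm at least [4^k], and let [x] be *)
(* a positive lift of an element above every [2^-k e_(n k)]. For any positive lift [z] *)
(* of [e_(n k)], the meet of [x] and [2^-k z] lifts [2^-k e_(n k)], so [e_(n k)] has *)
(* a lift of norm at most [2^k |x|]. *)
Lemma hom_bounded_lift : exists C : R, forall n, exists f : FBL E,
  [/\ forall u, 0 <= f u, `|f| <= C & T f = ell1_basis n].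
Proof.
apply: contrapT => nC.
have H k : {n | forall f : FBL E, (forall u, 0 <= f u) -> T f = ell1_basis n ->
    (geom k)^-1 ^+ 2 <= `|f|}.
  apply/cid; apply: contrapT => nk; apply: nC; exists ((geom k)^-1 ^+ 2) => n.
  apply: contrapT => nf; apply: nk; exists n => f f0 fn.
  by rewrite leNgt; apply/negP => /ltW fk; apply: nf; exists f.
have [y yP] := @geom_dominate (ell1 R) nat (fun i x => x i)
  (fun _ _ _ _ => erefl) (@ell1_coord_continuous R) (fun k => ell1_basis (sval (H k)))
  (fun k => ell1_basis_norm _) (fun k i => ell1_basis_ge0 _ _).
have [x x0 xy] := @hom_positive_lift y (fun i => le_trans
  (mulr_ge0 (ltW (geom_gt0 0)) (ell1_basis_ge0 (sval (H 0%N)) i)) (yP 0%N i)).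
have [k] := unbounded_geom `|x|; apply.
have gk : 0 < geom k :> R := geom_gt0 k.
have gV : 0 < (geom k)^-1 :> R by rewrite invr_gt0.
have [z z0 zn] := hom_positive_lift (@ell1_basis_ge0 (sval (H k))).
pose v : FBL E := (geom k)^-1 *: vmeet x (geom k *: z).
have v0 u : 0 <= v u.
  by apply: mulr_ge0; rewrite ?(ltW gV)//= le_min x0/= mulr_ge0// ltW.
have Tv : T v = ell1_basis (sval (H k)).
  apply/val_inj/funext => i; rewrite /v linearZ.
  change ((geom k)^-1 * T (vmeet x (geom k *: z)) i = ell1_basis (sval (H k)) i :> R).
  rewrite hom_meetE linearZ zn xy (min_idPr _); last exact: yP.
  change ((geom k)^-1 * (geom k * ell1_basis (sval (H k)) i) = ell1_basis (sval (H k)) i :> R).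
  by rewrite mulrA mulVf ?gt_eqF// mul1r.
have := svalP (H k) v v0 Tv; rewrite /v normrZ (gtr0_norm gV) expr2 ler_pM2l//.
move=> /le_trans; apply; apply: fbl_norm_mono => u /=.
rewrite !ger0_norm// ?ge_min ?lexx// le_min x0/= mulr_ge0//; exact: ltW.
Qed.

(* For bounded positive lifts [x n] of the [e_n] and [w = sum_k 2^-k x k], the *)
(* elements [u n = (2 x n - 2^n w)^+] are disjoint, since two summands of [w] cannot *)
(* both exceed [w / 2]; they still lift the [e_n]. *)
Lemma hom_section : exists S : {linear ell1 R -> FBL E},
  [/\ lattice_hom S, continuous S & cancel S T].
Proof.
have cT := hom_continuous.
have [C HC] := hom_bounded_lift.
pose x n := sval (cid (HC n)).
have x0 n : forall u, 0 <= x n u by have [] := svalP (cid (HC n)).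
have xC n : `|x n| <= C by have [] := svalP (cid (HC n)).
have Tx n : T (x n) = ell1_basis n by have [] := svalP (cid (HC n)).
have [A [_ Alim _]] := ell1_sum xC.
pose w := A ell1_geom.
have wlim u : \sum_(0 <= n < N) geom n * x n u @[N --> \oo] --> w u.
  have := cvg_comp _ _ (Alim ell1_geom) (@fbl_eval_continuous R E u w).
  apply: cvg_trans; apply: near_eq_cvg; apply: nearW => N /=.
  by rewrite fbl_sumE.
have w_ge2 i j u : i != j -> geom i * x i u + geom j * x j u <= w u.
  move=> ij; apply: (ler_cvg_to (cvg_cst _) (wlim u)).
  exists (maxn i j).+1 => // N /=; rewrite gtn_max => /andP[iN jN].
  rewrite big_mkord (bigD1 (Ordinal iN))//= lerD2l.
  rewrite (bigD1 (Ordinal jN))/=; last by rewrite -val_eqE/= eq_sym.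
  by rewrite lerDl sumr_ge0// => n _; rewrite mulr_ge0// ltW// geom_gt0.
have w_ge i u : geom i * x i u <= w u.
  have := @w_ge2 i i.+1 u; rewrite neq_ltn ltnSn => /(_ isT); apply: le_trans.
  by rewrite lerDl mulr_ge0// ltW// geom_gt0.
have Tw i : T w i = geom i.
  by rewrite (ell1_sum_section cT Alim Tx).
pose u n : FBL E := vjoin 0 (2 *: x n - (geom n)^-1 *: w).
have gV n : 0 < (geom n)^-1 :> R by rewrite invr_gt0 geom_gt0.
have uE n v : u n v = Num.max 0 (2 * x n v - (geom n)^-1 * w v) by [].
have u0 n v : 0 <= u n v by rewrite uE le_max lexx.
have ux n v : u n v <= x n v.
  rewrite uE ge_max x0/=; have := w_ge n v; rewrite -ler_pdivlMl ?geom_gt0//.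
  by lra.
have Tu n : T (u n) = ell1_basis n.
  apply/val_inj/funext => i; rewrite -[LHS]/(T (vjoin 0 (2 *: x n - (geom n)^-1 *: w)) i).
  rewrite hom_joinE linear0 linearB !linearZ Tx.
  change (Num.max 0 (2 * ell1_basis n i + (geom n)^-1 * (- T w i)) = ell1_basis n i :> R).
  rewrite Tw ell1_basisE mulrN; case: eqVneq => [->|_].
    by rewrite mulVf ?gt_eqF ?geom_gt0// mulr1 (_ : 2 - 1 = 1 :> R) ?(max_idPr _)//; lra.
  rewrite mulr0 sub0r (max_idPl _)// oppr_le0 mulr_ge0// ltW//; exact: geom_gt0.
have disj v : exists i, forall n, n != i -> u n v = 0.
  have [[i ui]|nu] := pselect (exists i, u i v != 0); last first.
    by exists 0%N => n _; apply: contrapT => /eqP un; apply: nu; exists n.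
  exists i => n ni; apply: contrapT => /eqP un.
  have pos m : u m v != 0 -> w v < 2 * (geom m * x m v).
    rewrite uE => um; have : 0 < 2 * x m v - (geom m)^-1 * w v.
      rewrite ltNge; apply/negP => /max_idPl um0; by rewrite um0 eqxx in um.
    by rewrite subr_gt0 ltr_pdivrMl ?geom_gt0// mulrCA.
  by have := pos _ ui; have := pos _ un; have := w_ge2 _ _ v ni; lra.
have uC n : `|u n| <= C.
  apply: le_trans (xC n); apply: fbl_norm_mono => v.
  by rewrite !ger0_norm.
have [S [SC Slim _]] := ell1_sum uC.
(* At each [v] the series for [S y] has at most one nonzero term, with [u i v] nonnegative; hence
   [S] commutes with meet and join. *)
have SE y v i : (forall n, n != i -> u n v = 0) -> S y v = y i * u i v.
  move=> ui.
  have lim := cvg_comp _ _ (Slim y) (@fbl_eval_continuous R E v (S y)).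
  apply: (cvg_unique _ lim) => //.
  have := @cvg_sum_single R R^o (fun n => y n * u n v) i.
  move=> /(_ _)/wrap[n ni|]; first by rewrite ui// mulr0.
  apply: cvg_trans; apply: near_eq_cvg; apply: nearW => N /=.
  by rewrite fbl_sumE.
exists S; split.
- split=> y z; apply: fbl_ext => v; have [i ui] := disj v.
    change (S (vmeet y z) v = Num.min (S y v) (S z v)).
    by rewrite !(SE _ _ _ ui) -minr_pMl.
  change (S (vjoin y z) v = Num.max (S y v) (S z v)).
  by rewrite !(SE _ _ _ ui) -maxr_pMl.
- apply/continuous_linearP; exists (`|C| + 1) => [|y]; first by rewrite ltr_wpDl.
  apply: le_trans (SC y) _; rewrite ler_wpM2r//.
  by apply: le_trans (ler_norm C) _; rewrite lerDl.
- exact: ell1_sum_section cT Slim Tu.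
Qed.

End Lift.
End Quotient.

(** * Weakly unconditionally Cauchy sequences in the dual *)

Section Rosenthal.
Context {R : realType}.

(* Split the indices into infinitely many infinite classes. If no class works, *)
(* each class contains a column with more than [e] of its mass inside the class, *)
(* so the columns selected lose [e] when restricted to one another. *)
Lemma rosenthal (a : nat -> nat -> R) (e : R) (m : nat) :
  0 < e -> (forall j k, 0 <= a j k) ->
  (forall k s, uniq s -> k \notin s -> \sum_(j <- s) a j k <= m%:R * e) ->
  exists2 t : nat -> nat, injective t &
    forall k s, uniq s -> k \notin s -> \sum_(j <- s) a (t j) (t k) <= e.
Proof.
move=> e0; elim: m a => [|m IH] a a0 am.
  exists id => // k s us ks; apply: le_trans (am k s us ks) _.
  by rewrite mul0r ltW.
pose p (i j : nat) : nat := pickle (i, j).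
have pI i j i' j' : p i j = p i' j' -> i = i' /\ j = j'.
  by move=> /(pcan_inj pickleK)[-> ->].
have [[i Hi]|no] := pselect (exists i, forall k s, uniq s -> k \notin s ->
    \sum_(j <- s) a (p i j) (p i k) <= e).
  by exists (p i) => // j k /pI[].
have H i : {ks : nat * seq nat | [/\ uniq ks.2, ks.1 \notin ks.2 &
    e < \sum_(j <- ks.2) a (p i j) (p i ks.1)]}.
  apply/cid; apply: contrapT => nk; apply: no; exists i => k s us ks.
  by rewrite leNgt; apply/negP => h; apply: nk; exists (k, s).
pose k i := (sval (H i)).1; pose S i := (sval (H i)).2.
pose t' i := p i (k i).
have t'I : injective t' by move=> i j /pI[].
have [|i s us is_|t tI Ht] := IH (fun i j => a (t' i) (t' j)).
- by move=> i j; exact: a0.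
- have [uS kS eS] := svalP (H i).
  have piI : injective (p i) by move=> j j' /pI[].
  have n1 : t' i \notin map t' s by rewrite mem_map.
  have n2 : t' i \notin map (p i) (S i) by rewrite /t' mem_map.
  have := am (t' i) (map t' s ++ map (p i) (S i)).
  rewrite big_cat/= !big_map cat_uniq mem_cat negb_or n1 n2 !map_inj_uniq// us uS/=.
  rewrite andbT => /(_ _ isT)/wrap[|h].
    apply/hasPn => _ /mapP[j _ ->]; apply/negP => /mapP[i' i's /pI[ii' _]].
    by move: is_; rewrite ii' i's.
  have -> : m%:R * e = m.+1%:R * e - e by rewrite -natr1; lra.
  by rewrite lerBrDr; apply: le_trans h; rewrite lerD2l ltW.
- by exists (t' \o t) => //; exact: inj_comp.
Qed.

Lemma sum_uniq_le (F : nat -> R) (s : seq nat) : (forall n, 0 <= F n) -> uniq s ->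
  exists N, \sum_(j <- s) F j <= \sum_(0 <= j < N) F j.
Proof.
move=> F0 us; pose N := (\max_(j <- s) j).+1; exists N.
have -> : \sum_(j <- s) F j = \sum_(0 <= j < N | j \in s) F j.
  have us' : uniq [seq j <- index_iota 0 N | j \in s].
    by rewrite filter_uniq// iota_uniq.
  rewrite -[RHS]big_filter; apply: (perm_big _ (uniq_perm us us' _)) => j.
  rewrite mem_filter mem_index_iota /= ltnS.
  by case: (boolP (j \in s)) => //= js; apply/esym/leq_bigmax_seq.
by rewrite [leLHS]big_mkcond/=; apply: ler_sum => j _; case: ifP.
Qed.

(** [W] inverts the identity plus [B]: [W x] is the fixed point of the contraction sending [z] to
    [x - B z]. Linearity follows from the trivial kernel, and the norm of [W] is at most 2. *)
Lemma small_perturbation (X : completeNormedModType R) (B : {linear X -> X}) :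
  (forall x, `|B x| <= 2^-1 * `|x|) ->
  exists2 W : {linear X -> X}, continuous W & forall x, W x + B (W x) = x.
Proof.
move=> B2.
have fix_ x : {w : X | w + B w = x}.
  apply/cid.
  have fH : {homo (fun z => x - B z) : z / [set: X] z >-> [set: X] z} by [].
  have q0 : 0 <= 2^-1 :> R by rewrite invr_ge0.
  have [//||w _ wE] := @banach_fixed_point R X setT (mkfun fH) _ closedT.
  - exists (NngNum q0); split=> /=; first by rewrite invf_lt1// ltr1n.
    move=> [y z] _ /=; rewrite opprD opprK addrACA subrr add0r addrC -linearB distrC.
    exact: B2.
  - by exists 0.
  - by exists w; move: wE => /= wE; rewrite {1}wE subrK.
have small w : w + B w = 0 -> w = 0.
  move=> /eqP; rewrite addr_eq0 => /eqP wE; apply/eqP; rewrite -normr_le0.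
  by have := B2 w; rewrite wE normrN -wE; have := normr_ge0 w; lra.
have lW (a : R) (x y : X) :
    sval (fix_ (a *: x + y)) = a *: sval (fix_ x) + sval (fix_ y).
  apply/eqP; rewrite -subr_eq0; apply/eqP/small.
  rewrite (raddfB B) (raddfD B)/= linearZ/= addrACA -opprD (svalP (fix_ _)) addrACA.
  by rewrite -scalerDr !(svalP (fix_ _)) subrr.
have [W WE] := @mk_linear _ _ _ (fun x => sval (fix_ x)) lW.
exists W => [|x]; last by rewrite WE (svalP (fix_ x)).
apply/continuous_linearP; exists 2 => // x; rewrite WE.
have := ler_normB (sval (fix_ x) + B (sval (fix_ x))) (B (sval (fix_ x))).
by rewrite addrK (svalP (fix_ x)); have := B2 (sval (fix_ x)); lra.
Qed.

(* After Rosenthal's lemma, [x |-> (y k x / y k (v k))_k] composed with *)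
(* [s |-> sum_k s k v k] is a perturbation of the identity of l1 of norm at most 1/2. *)
Lemma wuc_retract (E : completeNormedModType R) (y : nat -> dual E) (v : nat -> E)
    (C c : R) : 0 < C -> 0 < c ->
  (forall x N, \sum_(0 <= k < N) `|y k x| <= C * `|x|) ->
  (forall k, `|v k| <= 1) -> (forall k, c <= y k (v k)) ->
  contains_complemented (ell1 R) E.
Proof.
move=> C0 c0 yC v1 yv; apply/complemented_retractP.
have yseq s x : uniq s -> \sum_(j <- s) `|y j x| <= C * `|x|.
  move=> us; have [N] := @sum_uniq_le (fun j => `|y j x|) s (fun=> normr_ge0 _) us.
  by move=> /le_trans; apply; exact: yC.
have c2 : 0 < c / 2 by rewrite divr_gt0.
(* Each column sums to at most [C], which is at most [m * (c / 2)] for this choice of [m]. *)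
have [|k s us _|t tI Ht] := @rosenthal (fun j k => `|y j (v k)|) (c / 2)
    (Num.bound (C / (c / 2))) c2.
- by move=> j k; exact: normr_ge0.
- apply: le_trans (yseq _ _ us) _; rewrite -ler_pdivrMr//.
  apply: (@le_trans _ _ (C / (c / 2))).
    by rewrite ler_pM2r ?invr_gt0// ler_piMr// ltW.
  by apply: ltW; apply: archi_boundP; rewrite divr_ge0// ltW.
pose d j := y (t j) (v (t j)).
have dc j : c <= d j by exact: yv.
have d0 j : 0 < d j by apply: lt_le_trans (dc j).
have dV j r : `|r / d j| <= c^-1 * `|r|.
  rewrite normrM normfV (gtr0_norm (d0 j)) mulrC ler_wpM2r// lef_pV2//; exact: d0.
have Qsum x s : uniq s -> \sum_(j <- s) `|y (t j) x / d j| <= c^-1 * (C * `|x|).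
  move=> us; apply: (@le_trans _ _ (c^-1 * \sum_(j <- s) `|y (t j) x|)).
    by rewrite mulr_sumr; apply: ler_sum => j _; exact: dV.
  rewrite ler_pM2l ?invr_gt0//.
  by have := yseq (map t s) x; rewrite big_map map_inj_uniq//; exact.
have Qmem x : (fun j => y (t j) x / d j) \in ell1_pred.
  apply: (@ell1_mem _ _ (c^-1 * (C * `|x|))) => N.
  by apply: Qsum; exact: iota_uniq.
have lQ : linear (fun x => Ell1 (Qmem x)).
  move=> a x z; apply/val_inj/funext => j.
  change (y (t j) (a *: x + z) / d j = a * (y (t j) x / d j) + y (t j) z / d j).
  by rewrite dual_linear mulrDl mulrA.
have [Q QE] := mk_linear lQ.
have cQ : continuous Q.
  apply/continuous_linearP; exists (c^-1 * C) => [|x]; first by rewrite mulr_gt0// invr_gt0.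
  rewrite QE; apply: ell1_norm_le => N; rewrite -mulrA.
  by apply: Qsum; exact: iota_uniq.
have [A [A1 Alim _]] := @ell1_sum _ _ (v \o t) 1 (fun n => v1 (t n)).
(* Division by [d] makes the diagonal entries 1; the others sum to at most [c / 2] by [Ht] and are
   divided by at least [c]. *)
have B2 n : `|Q (v (t n)) - ell1_basis n| <= 2^-1.
  apply: ell1_norm_le => N; rewrite QE.
  apply: (@le_trans _ _ (\sum_(0 <= j < N | j != n) (c^-1 * `|y (t j) (v (t n))|))).
    rewrite [leRHS]big_mkcond/=; apply: ler_sum => j _.
    change (`|y (t j) (v (t n)) / d j - ell1_basis n j| <=
      if j != n then c^-1 * `|y (t j) (v (t n))| else 0).
    rewrite ell1_basisE; case: eqVneq => [->|_]/=; last by rewrite subr0.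
    by rewrite -/(d n) divff ?gt_eqF// subrr normr0.
  rewrite -mulr_sumr ler_pdivrMl// mulrC.
  rewrite -big_filter (_ : 2^-1 * c = c / 2)//; last by rewrite mulrC.
  by apply: Ht; rewrite ?filter_uniq ?iota_uniq// mem_filter eqxx.
have [B [BC Blim _]] := ell1_sum B2.
have QA s : Q (A s) = s + B s.
  apply/val_inj/funext => i; apply/eqP; rewrite -subr_eq; apply/eqP.
  change (Q (A s) i - B s i = s i).
  have limQ := cvg_comp _ _ (cvg_comp _ _ (Alim s) (cQ (A s)))
    (@ell1_coord_continuous R i (Q (A s))).
  have limB := cvg_comp _ _ (Blim s) (@ell1_coord_continuous R i (B s)).
  apply: (cvg_unique _ (cvgB limQ limB)) => //.
  have lims : \sum_(0 <= n < N) s n * ell1_basis n i @[N --> \oo] -->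
      s i * ell1_basis i i.
    apply: (@cvg_sum_single R R^o (fun n => s n * ell1_basis n i)) => n ni.
    by rewrite ell1_basisE eq_sym (negbTE ni) mulr0.
  move: lims; rewrite ell1_basisE eqxx mulr1.
  have partE N : Q (\sum_(0 <= n < N) s n *: v (t n)) i -
      (\sum_(0 <= n < N) s n *: (Q (v (t n)) - ell1_basis n)) i =
      \sum_(0 <= n < N) s n * ell1_basis n i.
    rewrite linear_sum !ell1_sumE -sumrB; apply: eq_bigr => n _; rewrite linearZ.
    change (s n * Q (v (t n)) i - s n * (Q (v (t n)) i - ell1_basis n i) =
      s n * ell1_basis n i).
    by rewrite -mulrBr opprB addrC subrK.
  by apply: cvg_trans; apply: near_eq_cvg; apply: nearW => N; rewrite -partE.
have [W cW WE] := @small_perturbation (ell1 R) B BC.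
exists (A \o W : {linear ell1 R -> E}), Q; split => //; last first.
  by move=> x /=; rewrite QA WE.
have cA : continuous A by apply/continuous_linearP; exists 1.
by move=> x; apply: continuous_comp; [exact: cW|exact: cA].
Qed.

End Rosenthal.

(** * The Hahn-Banach theorem *)

Section HahnBanach.
Context {R : realType} {V : lmodType R}.
Implicit Types p q : V -> R.

Definition sublinear p :=
  (forall x y, p (x + y) <= p x + p y) /\
  (forall (a : R) x, 0 <= a -> p (a *: x) <= a * p x).

Lemma sublinear0 p : sublinear p -> p 0 = 0.
Proof.
move=> [pD pZ]; apply/eqP; rewrite eq_le; apply/andP; split.
  by have := pZ 0 0 (lexx 0); rewrite scale0r mul0r.
by have := pD 0 0; rewrite addr0; lra.
Qed.

Lemma sublinear_ge p x : sublinear p -> - p (- x) <= p x.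
Proof.
move=> hp; have := hp.1 x (- x); rewrite subrr sublinear0//; lra.
Qed.

(** In a chain, the smaller of two members serves for both summands, so the pointwise infimum stays
    subadditive. It is finite because every member is at least [- q (- x)] at [x]. *)
Lemma sublinear_chain_inf (A : set (V -> R)) q : A !=set0 ->
  (forall p, A p -> sublinear p /\ forall x, p x <= q x) ->
  (forall p p', A p -> A p' -> (forall x, p x <= p' x) \/ (forall x, p' x <= p x)) ->
  exists2 m, sublinear m & forall p, A p -> forall x, m x <= p x.
Proof.
move=> [p0 Ap0] Asub Atot.
pose m x := inf [set p x | p in A].
have mle p x : A p -> m x <= p x.
  move=> Ap; apply: ge_inf; last by exists p.
  exists (- q (- x)) => _ [p' Ap' <-]; have [hp' p'q] := Asub _ Ap'.
  by apply: le_trans (sublinear_ge _ hp'); rewrite lerN2.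
have m_ge x r : (forall p, A p -> r <= p x) -> r <= m x.
  move=> rp; apply: lb_le_inf; first by exists (p0 x), p0.
  by move=> _ [p Ap <-]; exact: rp.
exists m => [|p Ap x]; last exact: mle.
split=> [x y|a x a0].
  rewrite -lerBlDl; apply: (m_ge) => p Ap; rewrite lerBlDl -lerBlDr.
  apply: (m_ge) => p' Ap'; rewrite lerBlDr.
  have [pp'|p'p] := Atot _ _ Ap Ap'.
    apply: le_trans (mle _ _ Ap) _; apply: le_trans ((Asub _ Ap).1.1 _ _) _.
    by rewrite lerD2r.
  apply: le_trans (mle _ _ Ap') _; apply: le_trans ((Asub _ Ap').1.1 _ _) _.
  by rewrite lerD2l.
have [->|an0] := eqVneq a 0.
  by rewrite scale0r mul0r -(sublinear0 (Asub _ Ap0).1) mle.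
have {an0}a0 : 0 < a by rewrite lt_neqAle eq_sym an0.
rewrite -ler_pdivrMl//; apply: (m_ge) => p Ap; rewrite ler_pdivrMl//.
by apply: le_trans (mle _ _ Ap) _; apply: (Asub _ Ap).1.2; exact: ltW.
Qed.

(** For fixed [y], the infimum over [t >= 0] of [p (z + t *: y) - t * p y] is a sublinear function
    of [z] below [p]. By minimality it equals [p], and [t = 1] gives superadditivity. *)
Lemma sublinear_minimal_linear p : sublinear p ->
  (forall p', sublinear p' -> (forall x, p' x <= p x) -> p' = p) ->
  linear (p : V -> R^o).
Proof.
move=> hp pmin.
have [pD pZ] := hp.
have superadd x y : p x + p y <= p (x + y).
  pose S z := [set r | exists2 t : R, 0 <= t & r = p (z + t *: y) - t * p y].
  have Sb z r : S z r -> - p (- z) <= r.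
    move=> [t t0 ->]; have := pD (z + t *: y) (- z); rewrite addrAC subrr add0r.
    have : t * p y <= p (t *: y); last by lra.
    have [->|tn0] := eqVneq t 0; first by rewrite mul0r scale0r sublinear0.
    have {}t0 : 0 < t by rewrite lt_neqAle eq_sym tn0.
    rewrite -ler_pdivlMl//.
    have := pZ t^-1 (t *: y); rewrite scalerA mulVf// scale1r; apply.
    by rewrite invr_ge0 ltW.
  have Slb z : has_lbound (S z) by exists (- p (- z)) => r; exact: Sb.
  pose p' z := inf (S z).
  have p'le z t : 0 <= t -> p' z <= p (z + t *: y) - t * p y.
    by move=> t0; apply: ge_inf => //; exists t.
  have lep' z r : (forall t, 0 <= t -> r <= p (z + t *: y) - t * p y) -> r <= p' z.
    move=> rp; apply: lb_le_inf; last by move=> _ [t t0 ->]; exact: rp.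
    by exists (p (z + 0 *: y) - 0 * p y), 0.
  have hp' : sublinear p'.
    split=> [z z'|a z a0].
      rewrite -lerBlDl; apply: (lep') => t t0; rewrite lerBlDl -lerBlDr.
      apply: (lep') => t' t'0; rewrite lerBlDr.
      apply: le_trans (p'le _ _ (addr_ge0 t'0 t0)) _.
      rewrite scalerDl addrACA; have := pD (z + t' *: y) (z' + t *: y); lra.
    have [->|an0] := eqVneq a 0.
      rewrite scale0r mul0r; apply: le_trans (p'le _ _ (lexx 0)) _.
      by rewrite scale0r mul0r addr0 subr0 sublinear0.
    have {an0}a0' : 0 < a by rewrite lt_neqAle eq_sym an0.
    rewrite -ler_pdivrMl//; apply: (lep') => t t0; rewrite ler_pdivrMl//.
    apply: le_trans (p'le _ _ (mulr_ge0 a0 t0)) _.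
    by rewrite -scalerA -scalerDr mulrBr mulrA lerD2r; exact: pZ.
  have p'p z : p' z <= p z.
    by apply: le_trans (p'le z 0 (lexx 0)) _; rewrite scale0r mul0r addr0 subr0.
  have := p'le x 1 ler01; rewrite (pmin _ hp' p'p) scale1r mul1r; lra.
have pA x y : p (x + y) = p x + p y by apply/eqP; rewrite eq_le pD superadd.
have pN x : p (- x) = - p x.
  by have := pA x (- x); rewrite subrr sublinear0//; lra.
have pZe (a : R) x : 0 <= a -> p (a *: x) = a * p x.
  move=> a0; apply/eqP; rewrite eq_le pZ//=.
  by have := pZ a (- x) a0; rewrite scalerN !pN mulrN lerN2.
move=> a x y; rewrite pA; congr (_ + _).
have [a0|/ltW a0] := leP 0 a; first exact: pZe.
have -> : a *: x = - ((- a) *: x) by rewrite scaleNr opprK.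
by rewrite pN pZe ?oppr_ge0// mulNr opprK.
Qed.

(* A minimal sublinear functional below [q] is linear, and Zorn's lemma *)
(* provides one. *)
Lemma hahn_banach q : sublinear q ->
  exists f : {linear V -> R^o}, forall x, f x <= q x.
Proof.
move=> hq.
suff [f lf fq] : exists2 f : V -> R, linear (f : V -> R^o) & forall x, f x <= q x.
  have [g gE] := mk_linear lf.
  by exists g => x; rewrite gE.
pose T := {p : V -> R | sublinear p /\ forall x, p x <= q x}.
pose below (s t : T) := `[< forall x, sval t x <= sval s x >].
have [||||t tmax] := @Zorn T below.
- by move=> t; apply/asboolP.
- by move=> r s t /asboolP rs /asboolP st; apply/asboolP => x; exact: le_trans (rs x).
- move=> [s hs] [t ht] /asboolP /= st /asboolP /= ts; apply/eq_exist/funext => x.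
  by apply/le_anti; rewrite st ts.
- move=> A Atot; have [[s0 As0]|A0] := pselect (A !=set0); last first.
    exists (exist _ q (conj hq (fun=> lexx _))) => s As; exfalso.
    by apply: A0; exists s.
  have [|_ [s _ <-]|_ _ [s As <-] [s' As' <-]|m hm mA] :=
      @sublinear_chain_inf [set sval s | s in A] q.
  + by exists (sval s0), s0.
  + exact: svalP s.
  + have [/asboolP ss'|/asboolP s's] := Atot _ _ As As'; [by right|by left].
  + have mq x : m x <= q x.
      by apply: le_trans (mA (sval s0) _ x) ((svalP s0).2 x); exists s0.
    exists (exist _ m (conj hm mq)) => s As; apply/asboolP => x /=.
    by apply: mA; exists s.
- exists (sval t); last exact: (svalP t).2.
  apply: sublinear_minimal_linear (svalP t).1 _ => p hp pt.
  have pq x : p x <= q x by apply: le_trans (pt x) ((svalP t).2 x).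
  have := tmax (exist _ p (conj hp pq)) (asboolT pt).
  by move=> <-.
Qed.

End HahnBanach.

(** * Order bounded families and a normal form in FBL *)

Section OrderBounded.
Context {R : realType} {E : normedModType R} {I : choiceType}.

(** The space on which [hahn_banach] is applied: a common order bound of the family is what keeps
    the sublinear functional [q] below finite. *)
Definition order_bounded_pred : {pred I -> FBL E} :=
  mem [set F : I -> FBL E | exists g : FBL E, forall i u, `|F i u| <= g u].

Lemma order_bounded_submod_closed : submod_closed order_bounded_pred.
Proof.
split; first by rewrite inE; exists 0 => i u /=; rewrite normr0.
move=> a F G; rewrite !inE => -[f Ff] [g Gg].
exists (`|a| *: f + g) => i u.
change (`|a * F i u + G i u| <= `|a| * f u + g u).
by apply: le_trans (ler_normD _ _) _; rewrite normrM lerD// ler_wpM2l.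
Qed.

HB.instance Definition _ := GRing.isSubmodClosed.Build R (I -> FBL E)
  order_bounded_pred order_bounded_submod_closed.

Record order_bounded : Type := OrderBounded
  { family_of :> I -> FBL E; family_ofP : family_of \in order_bounded_pred }.

HB.instance Definition _ := [isSub for family_of].
HB.instance Definition _ := [Choice of order_bounded by <:].
HB.instance Definition _ := [SubChoice_isSubLmodule of order_bounded by <:].

Lemma restriction_mem (s : seq I) (F : I -> FBL E) :
  (fun i => if i \in s then F i else 0) \in order_bounded_pred.
Proof.
rewrite inE; exists (\sum_(j <- s) fbl_abs (F j)) => i u.
have Es : (\sum_(j <- s) fbl_abs (F j)) u = \sum_(j <- s) `|F j u|.
  by rewrite fbl_sumE; apply: eq_bigr => j _; rewrite fbl_absE.
rewrite Es; case: ifPn => is_; last by rewrite normr0 sumr_ge0.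
by rewrite (big_rem i is_)/= lerDl sumr_ge0.
Qed.

Definition restriction s F := OrderBounded (restriction_mem s F).

Lemma order_bounded_ext (F G : order_bounded) : (forall i u, F i u = G i u) -> F = G.
Proof. by move=> FG; apply/val_inj/funext => i; apply: fbl_ext. Qed.

Lemma restriction_sum (f : {linear order_bounded -> R^o}) (s : seq I) (F : I -> FBL E) :
  uniq s -> f (restriction s F) = \sum_(i <- s) f (restriction [:: i] F).
Proof.
elim: s => [_|i s IH /= /andP[is_ us]].
  by rewrite big_nil -[RHS](linear0 f); congr (f _); apply: order_bounded_ext.
rewrite big_cons -IH// -linearD; congr (f _).
apply: order_bounded_ext => j u.
change ((if j \in i :: s then F j else 0) u =
  (if j \in [:: i] then F j else 0) u + (if j \in s then F j else 0) u).
rewrite !inE; case: eqVneq => [->|_]/=; last by rewrite add0r.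
by rewrite (negbTE is_) addr0.
Qed.

End OrderBounded.

Section NormalForm.
Context {R : realType} {E : normedModType R}.
Implicit Types (f g h : FBL E) (u : dual E).

(** [h] is the finite supremum of the [delta a]. That it is attained at every functional is what the
    estimates below use. *)
Definition is_max_of (A : seq E) h : Prop :=
  (forall a u, a \in A -> u a <= h u) /\ (forall u, exists2 a, a \in A & h u = u a).

Lemma is_max_ofD A B g h : is_max_of A g -> is_max_of B h ->
  is_max_of [seq a + b | a <- A, b <- B] (g + h).
Proof.
move=> [gA Ag] [hB Bh]; split=> [_ u /allpairsP[[a b] [/= aA bB ->]]|u].
  by rewrite -[a]scale1r dual_linear mul1r; apply: lerD; [exact: gA|exact: hB].
have [a aA ga] := Ag u; have [b bB hb] := Bh u.
exists (a + b); first by apply/allpairsP; exists (a, b).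
by rewrite -[a]scale1r dual_linear mul1r -ga -hb.
Qed.

Lemma is_max_ofZ (c : R) A g : 0 <= c -> is_max_of A g ->
  is_max_of [seq c *: a | a <- A] (c *: g).
Proof.
move=> c0 [gA Ag]; split=> [_ u /mapP[a aA ->]|u].
  by rewrite dualZ; apply: ler_wpM2l => //; exact: gA.
have [a aA ga] := Ag u; exists (c *: a); first exact: map_f.
by rewrite dualZ -ga.
Qed.

Lemma is_max_of_join A B g h : is_max_of A g -> is_max_of B h ->
  is_max_of (A ++ B) (vjoin g h).
Proof.
move=> [gA Ag] [hB Bh]; split=> [a u|u].
  by rewrite mem_cat /= le_max => /orP[/gA ->|/hB ->]; rewrite ?orbT.
have [a aA ga] := Ag u; have [b bB hb] := Bh u; rewrite /=.
have [_|_] := leP (g u) (h u); [exists b|exists a] => //;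
  by rewrite mem_cat ?aA ?bB ?orbT.
Qed.

Lemma is_max_of_delta a : is_max_of [:: a] (fbl_delta a).
Proof.
by split=> [b u|u]; [rewrite inE => /eqP ->|exists a; rewrite ?inE].
Qed.

(** Differences of finite maxima form a function sublattice: a negative scalar exchanges the two
    parts, and adding [h1 + h2] turns the maximum of [g1 - h1] and [g2 - h2] into that of [g1 + h2]
    and [g2 + h1]. *)
Lemma fbl_generated_normal_form (f : dual E -> R) : fbl_generated f ->
  exists A B g h, [/\ is_max_of A g, is_max_of B h & forall u, f u = g u - h u].
Proof.
pose S : set (dual E -> R) := [set f | exists A B g h,
  [/\ is_max_of A g, is_max_of B h & forall u, f u = g u - h u]].
have S0 : S 0.
  exists [:: 0], [:: 0], (fbl_delta 0), (fbl_delta 0).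
  by split; [exact: is_max_of_delta|exact: is_max_of_delta|move=> u; rewrite subrr].
move=> Sf; apply: (Sf S); split; first split => //.
- move=> c f1 f2 [A1 [B1 [g1 [h1 [Ag1 Bh1 f1E]]]]] [A2 [B2 [g2 [h2 [Ag2 Bh2 f2E]]]]].
  have [c0|/ltW c0] := leP 0 c.
    have := is_max_ofD (is_max_ofZ c0 Ag1) Ag2.
    have := is_max_ofD (is_max_ofZ c0 Bh1) Bh2.
    move=> Bh Ag; do 4 eexists; split; [exact: Ag|exact: Bh|move=> u].
    change (c * f1 u + f2 u = (c * g1 u + g2 u) - (c * h1 u + h2 u)).
    by rewrite f1E f2E; lra.
  have c0' : 0 <= - c by rewrite oppr_ge0.
  have := is_max_ofD (is_max_ofZ c0' Bh1) Ag2.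
  have := is_max_ofD (is_max_ofZ c0' Ag1) Bh2.
  move=> Bh Ag; do 4 eexists; split; [exact: Ag|exact: Bh|move=> u].
  change (c * f1 u + f2 u = (- c * h1 u + g2 u) - (- c * g1 u + h2 u)).
  by rewrite f1E f2E; lra.
- move=> f1 f2 [A1 [B1 [g1 [h1 [Ag1 Bh1 f1E]]]]] [A2 [B2 [g2 [h2 [Ag2 Bh2 f2E]]]]].
  have Agh := is_max_ofD Ag1 Bh2; have Ahg := is_max_ofD Ag2 Bh1.
  split.
    have Ag := is_max_ofD Ag1 Ag2.
    have Bh := is_max_of_join (is_max_ofD Ag1 Bh2) (is_max_ofD Ag2 Bh1).
    do 4 eexists; split; [exact: Ag|exact: Bh|move=> u].
    change (Num.min (f1 u) (f2 u) = g1 u + g2 u - Num.max (g1 u + h2 u) (g2 u + h1 u)).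
    rewrite f1E f2E; case: (leP (g1 u - h1 u)); case: (leP (g1 u + h2 u)); lra.
  have Bh := is_max_ofD Bh1 Bh2.
  have Ag := is_max_of_join (is_max_ofD Ag1 Bh2) (is_max_ofD Ag2 Bh1).
  do 4 eexists; split; [exact: Ag|exact: Bh|move=> u].
  change (Num.max (f1 u) (f2 u) = Num.max (g1 u + h2 u) (g2 u + h1 u) - (h1 u + h2 u)).
  rewrite f1E f2E; case: (leP (g1 u - h1 u)); case: (leP (g1 u + h2 u)); lra.
- move=> _ [x _ <-]; exists [:: x], [:: 0], (fbl_delta x), (fbl_delta 0).
  split; [exact: is_max_of_delta|exact: is_max_of_delta|move=> u].
  by rewrite /= /delta dual0 subr0.
Qed.

End NormalForm.

(** * From lower l1-estimates of suprema to functionals on E *)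

Section LowerEstimate.
Context {R : realType} {E : normedModType R}.

(* The sup of the [t k *: f k], [k < m], has norm at least [c] times the sum of *)
(* the [t k]; stated through upper bounds [G] of this family. *)
Definition sup_lower_l1 (f : nat -> FBL E) (c : R) : Prop :=
  forall (t : nat -> R) (m : nat) (G : FBL E), (forall k, 0 <= t k) ->
    (forall u, 0 <= G u) ->
    (forall k u, (k < m)%N -> t k * f k u <= G u) ->
  c * \sum_(0 <= k < m) t k <= `|G|.

(** Approximating each [f k] within [c / 2] costs half of the constant: adding the
    [t k *: fbl_abs (d k)] to an upper bound for the approximants gives one for the [t k *: f k],
    whose norm grows by at most [c / 2] times the sum of the [t k]. *)
Lemma sup_lower_l1_normal_form (f : nat -> FBL E) (C c : R) : 0 < c ->
  (forall k, `|f k| <= C) -> sup_lower_l1 f c ->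
  exists A B g h, [/\ forall k, is_max_of (A k) (g k),
    forall k, is_max_of (B k) (h k), forall k, `|g k - h k| <= C + c / 2 &
    sup_lower_l1 (fun k => g k - h k) (c / 2)].
Proof.
move=> c0 fC fc; have c2 : 0 < c / 2 by rewrite divr_gt0.
have H k : {p : (seq E * seq E) * (FBL E * FBL E) | [/\ is_max_of p.1.1 p.2.1,
    is_max_of p.1.2 p.2.2 & `|f k - (p.2.1 - p.2.2)| <= c / 2]}.
  apply/cid; have := fblP (f k); rewrite inE => -[_ _ /(_ _ c2)[f' f'gen fD]].
  have [A [B [g [h [Ag Bh f'E]]]]] := fbl_generated_normal_form f'gen.
  exists ((A, B), (g, h)); split => //=.
  have fE : fbl_fun (f k - (g - h)) = fbl_fun (f k) - f'.
    by apply/funext => u; rewrite -[RHS]/(f k u - f' u) f'E.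
  by rewrite -lee_fin -fbl_norm_fin fE ltW.
pose p k := sval (H k).
pose d k : FBL E := f k - ((p k).2.1 - (p k).2.2).
have dc k : `|d k| <= c / 2 by have [] := svalP (H k).
exists (fun k => (p k).1.1), (fun k => (p k).1.2), (fun k => (p k).2.1), (fun k => (p k).2.2).
split=> [k|k|k|t m G t0 G0 tG].
- by have [] := svalP (H k).
- by have [] := svalP (H k).
- have -> : (p k).2.1 - (p k).2.2 = f k - d k by rewrite /d subKr.
  by apply: le_trans (ler_normB _ _) _; exact: lerD.
- have [G' G'E G'n] : exists2 G' : FBL E,
      (forall u, G' u = G u + \sum_(0 <= k < m) t k * `|d k u|) &
      `|G'| <= `|G| + c / 2 * \sum_(0 <= k < m) t k.
    exists (G + \sum_(0 <= k < m) t k *: fbl_abs (d k)) => [u|].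
      rewrite -[LHS]/(G u + (\sum_(0 <= k < m) t k *: fbl_abs (d k)) u) fbl_sumE.
      by congr (_ + _); apply: eq_bigr => k _; rewrite -fbl_absE.
    apply: le_trans (ler_normD _ _) _; rewrite lerD2l mulr_sumr.
    apply: le_trans (ler_norm_sum _ _ _) _; apply: ler_sum => k _.
    rewrite normrZ ger0_norm// mulrC ler_wpM2r//.
    exact: le_trans (fbl_abs_norm _) (dc k).
  have sumd u : 0 <= \sum_(0 <= k < m) t k * `|d k u|.
    by apply: sumr_ge0 => k _; exact: mulr_ge0.
  have := fc t m G' t0 _ _ => /(_ _ _)/wrap[u|k u km|h].
  + by rewrite G'E addr_ge0.
  + rewrite G'E; have := tG k u km.
    have : t k * `|d k u| <= \sum_(0 <= k < m) t k * `|d k u|.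
      rewrite (bigD1_seq k) ?iota_uniq ?mem_index_iota//= lerDl.
      by apply: sumr_ge0 => j _; exact: mulr_ge0.
    have : t k * d k u <= t k * `|d k u| by rewrite ler_wpM2l// ler_norm.
    have -> : t k * d k u = t k * f k u - t k * ((p k).2.1 u - (p k).2.2 u).
      by rewrite -mulrBr.
    change (((p k).2.1 - (p k).2.2) u) with ((p k).2.1 u - (p k).2.2 u); lra.
  + by move: h G'n; lra.
Qed.

Context (A B : nat -> seq E) (g h : nat -> FBL E) (c : R).
Hypotheses (Ag : forall k, is_max_of (A k) (g k)) (Bh : forall k, is_max_of (B k) (h k)).
Hypotheses (c0 : 0 < c) (ghc : sup_lower_l1 (fun k => g k - h k) c).

Let I : choiceType := (nat * E)%type.
Local Notation V := (@order_bounded R E I).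
(** The supremum of [w (k, a)] over [a \in A k] is [g k - h k]. *)
Let w (i : I) : FBL E := fbl_delta i.2 - h i.1.

Let cV0 : 0 <= c^-1. Proof. by rewrite invr_ge0 ltW. Qed.

(* Mazur-Orlicz: [inf (Qset F)] is the sublinear functional whose linear minorants *)
(* [Psi] satisfy both [Psi F <= c^-1 |G|] whenever [F <= G], and [1 <= Psi (w_k)], where *)
(* [w_k] is [w] restricted to the block [{k} x A k]. *)
Let Qset (F : V) := [set r : R | exists (t : nat -> R) m (G : FBL E),
  [/\ forall k, 0 <= t k, forall k, (m <= k)%N -> t k = 0, forall u, 0 <= G u,
    forall i u, F i u + (if i.2 \in A i.1 then t i.1 * w i u else 0) <= G u &
    r = c^-1 * `|G| - \sum_(0 <= k < m) t k]].

(** The only use of the lower estimate. Evaluating the constraint at an [a] where [g k] attains its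
    value at [u] shows that [G + G0] is above every [t k *: (g k - h k)]. *)
Let Qset_ge (F : V) r (G0 : FBL E) :
  Qset F r -> (forall i u, `|F i u| <= G0 u) -> - (c^-1 * `|G0|) <= r.
Proof.
move=> [t [m [G [t0 tm G_ge0 FG ->]]]] FG0.
have G0_ge0 u : 0 <= G0 u by exact: le_trans (normr_ge0 _) (FG0 (0%N, 0) u).
have : c * \sum_(0 <= k < m) t k <= `|G + G0|.
  apply: ghc => // [u|k u _]; first exact: (addr_ge0 (G_ge0 u) (G0_ge0 u)).
  have [a aA ga] := (Ag k).2 u.
  have := FG (k, a) u; have := lerNnormlW (FG0 (k, a) u); rewrite /= aA.
  change (- G0 u <= F (k, a) u -> F (k, a) u + t k * (u a - h k u) <= G u ->
    t k * (g k u - h k u) <= G u + G0 u).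
  by rewrite ga; lra.
rewrite -ler_pdivlMl// => /le_trans/(_ (_ : _ <= c^-1 * (`|G| + `|G0|))).
move=> /(_ _)/wrap[|]; first by rewrite (ler_wpM2l cV0)// ler_normD.
by rewrite mulrDr; lra.
Qed.

Let q F := inf (Qset F).

Let Qlb (F : V) : has_lbound (Qset F).
Proof.
have /set_mem[G0 FG0] := family_ofP F.
by exists (- (c^-1 * `|G0|)) => r Fr; exact: Qset_ge Fr FG0.
Qed.

Let q_le F r : Qset F r -> q F <= r.
Proof. by move=> Fr; apply: ge_inf => //; exact: Qlb. Qed.

Let Qset0 (F : V) (G : FBL E) : (forall u, 0 <= G u) ->
  (forall i u, F i u <= G u) -> Qset F (c^-1 * `|G|).
Proof.
move=> G0 FG; exists (fun=> 0), 0%N, G; split => //; last by rewrite big_geq// subr0.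
by move=> i u; rewrite mul0r if_same addr0.
Qed.

Let q_ge F r : (forall r', Qset F r' -> r <= r') -> r <= q F.
Proof.
move=> Fr; apply: lb_le_inf => //.
have /set_mem[G0 FG0] := family_ofP F.
exists (c^-1 * `|G0|); apply: Qset0 => [u|i u].
  exact: le_trans (normr_ge0 _) (FG0 (0%N, 0) u).
exact: le_trans (ler_norm _) (FG0 i u).
Qed.

(** Two witnesses in [Qset] of different lengths can thus be added. *)
Let sum_extend (t : nat -> R) m n : (forall k, (m <= k)%N -> t k = 0) ->
  \sum_(0 <= k < m + n) t k = \sum_(0 <= k < m) t k.
Proof.
move=> tm; rewrite (@big_cat_nat _ _ _ m)//= ?leq_addr// [X in _ + X]big_nat_cond.
by rewrite [X in _ + X]big1 ?addr0// => k /andP[/andP[mk _] _]; exact: tm.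
Qed.

Let q_sublinear : sublinear q.
Proof.
split=> [F F'|a F a0].
  rewrite -lerBlDl; apply: (q_ge) => r' F'r'; rewrite lerBlDl -lerBlDr.
  apply: (q_ge) => r Fr; rewrite lerBlDr.
  move: Fr F'r' => [t [m [G [t0 tm G0 FG ->]]]] [t' [m' [G' [t'0 t'm G'0 FG' ->]]]].
  apply: (@le_trans _ _ (c^-1 * `|G + G'| - \sum_(0 <= k < m + m') (t k + t' k))).
    apply: q_le; exists (fun k => t k + t' k), (m + m')%N, (G + G').
    split => // [k|k mk|u|i u].
    - exact: addr_ge0.
    - rewrite tm ?t'm ?addr0//; first exact: leq_trans (leq_addl _ _) mk.
      exact: leq_trans (leq_addr _ _) mk.
    - exact: (addr_ge0 (G0 u) (G'0 u)).
    - have := FG i u; have := FG' i u.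
      change ((F + F') i u) with (F i u + F' i u).
      change ((G + G') u) with (G u + G' u).
      by case: ifP => _; rewrite ?mulrDl; lra.
  rewrite big_split/= sum_extend// [in X in _ - (_ + X)]addnC sum_extend//.
  have : c^-1 * `|G + G'| <= c^-1 * (`|G| + `|G'|).
    by rewrite (ler_wpM2l cV0)// ler_normD.
  by rewrite mulrDr; lra.
have aF r : Qset F r -> q (a *: F) <= a * r.
  move=> [t [m [G [t0 tm G0 FG ->]]]]; apply: q_le.
  exists (fun k => a * t k), m, (a *: G); split => [k|k mk|u|i u|].
  - exact: (mulr_ge0 a0 (t0 k)).
  - by rewrite tm// mulr0.
  - exact: (mulr_ge0 a0 (G0 u)).
  - change (a * F i u + (if i.2 \in A i.1 then a * t i.1 * w i u else 0) <= a * G u).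
    have := ler_wpM2l a0 (FG i u); rewrite mulrDr; congr (_ + _ <= _).
    by case: ifP => _; rewrite ?mulr0 ?mulrA.
  - by rewrite normrZ ger0_norm// mulrBr mulr_sumr mulrCA.
have [a_0|an0] := eqVneq a 0.
  rewrite a_0 mul0r scale0r.
  have := @q_le 0 _ (@Qset0 0 0 (fun=> lexx _) (fun _ _ => lexx _)).
  by rewrite normr0 mulr0.
have {an0}a0' : 0 < a by rewrite lt_neqAle eq_sym an0.
by rewrite -ler_pdivrMl//; apply: (q_ge) => r Fr; rewrite ler_pdivrMl//; exact: aF.
Qed.

(* [X k a v = Psi (delta v placed at (k, a))]. As [Psi] is positive, evaluating the *)
(* maximum [h k] at [X k a] gives at most [Psi (h k placed at (k, a))]. *)
Lemma sup_lower_l1_functionals : exists X : nat -> E -> dual E,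
  (forall (s : seq (nat * E)) v, uniq s ->
     \sum_(i <- s) `|X i.1 i.2 v| <= c^-1 * `|v|) /\
  (forall k, uniq (A k) -> 1 <= \sum_(a <- A k) (g k - h k) (X k a)).
Proof.
have [Psi Psiq] := hahn_banach q_sublinear.
have Psi_bound (F : V) (G : FBL E) : (forall i u, `|F i u| <= G u) -> Psi F <= c^-1 * `|G|.
  move=> FG; apply: le_trans (Psiq F) _; apply: q_le; apply: Qset0 => [u|i u].
    exact: le_trans (normr_ge0 _) (FG (0%N, 0) u).
  exact: le_trans (ler_norm _) (FG i u).
have Psi_le0 (F : V) : (forall i u, F i u <= 0) -> Psi F <= 0.
  move=> F0; apply: le_trans (Psiq F) _; apply: q_le.
  have := @Qset0 F 0 (fun=> lexx _) F0; rewrite normr0 mulr0; exact.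
pose e (i : I) (f : FBL E) : V := restriction [:: i] (fun=> f).
have el i : linear (e i).
  move=> a f f'; apply: order_bounded_ext => j u.
  change ((if j \in [:: i] then a *: f + f' else 0) u =
    a * (if j \in [:: i] then f else 0) u + (if j \in [:: i] then f' else 0) u).
  by case: ifP => //= _; rewrite mulr0 addr0.
have restrE (s : seq I) (F : I -> FBL E) : uniq s ->
    Psi (restriction s F) = \sum_(i <- s) Psi (e i (F i)).
  move=> us; rewrite restriction_sum//; apply: eq_bigr => i _; congr (Psi _).
  apply: order_bounded_ext => j u.
  change ((if j \in [:: i] then F j else 0) u = (if j \in [:: i] then F i else 0) u).
  by rewrite inE; case: eqVneq => [->|].
(* Inserting the signs turns the sum of absolute values into one value of [Psi], at a family bounded
   by [fbl_abs f]. *)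
have sum_bound (s : seq I) (f : FBL E) : uniq s ->
    \sum_(i <- s) `|Psi (e i f)| <= c^-1 * `|f|.
  move=> us.
  have -> : \sum_(i <- s) `|Psi (e i f)| =
      Psi (restriction s (fun i => Num.sg (Psi (e i f)) *: f)).
    rewrite restrE//; apply: eq_bigr => i _.
    have [ei eiE] := mk_linear (el i).
    by rewrite -!eiE linearZ linearZ/= normrEsg.
  apply: le_trans (Psi_bound _ (fbl_abs f) _) _ => [i u|].
    rewrite fbl_absE.
    change (`|(if i \in s then Num.sg (Psi (e i f)) *: f else 0) u| <= `|f u|).
    case: ifP => _; last by rewrite normr0.
    change (`|Num.sg (Psi (e i f)) * f u| <= `|f u|).
    by rewrite normrM ler_piMl// normr_sg; case: (_ == 0).
  by rewrite (ler_wpM2l cV0)// fbl_abs_norm.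
have X_ i : {x : dual E | forall v, x v = Psi (e i (fbl_delta v))}.
  apply/cid; apply: (@mk_dual _ _ _ c^-1); first by rewrite invr_gt0.
    move=> a x y; have [ei eiE] := mk_linear (el i).
    rewrite -!eiE -!linearP; congr (Psi (ei _)).
    by apply: fbl_ext => u; exact: dual_linear.
  move=> v; have := @sum_bound [:: i] (fbl_delta v) isT; rewrite big_seq1.
  move=> /le_trans; apply.
  by rewrite (ler_wpM2l cV0)// fbl_delta_norm_le.
pose X k a := sval (X_ (k, a)).
have XE k a v : X k a v = Psi (e (k, a) (fbl_delta v)) by exact: (svalP (X_ (k, a))).
exists X; split=> [s v us|k uA].
  under eq_bigr do rewrite XE.
  rewrite (eq_bigr (fun i => `|Psi (e i (fbl_delta v))|)); last by case.
  apply: le_trans (sum_bound _ _ us) _.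
  by rewrite (ler_wpM2l cV0)// fbl_delta_norm_le.
have eB i (f f' : FBL E) : Psi (e i (f - f')) = Psi (e i f) - Psi (e i f').
  by have [ei eiE] := mk_linear (el i); rewrite -!eiE !linearB.
have Psi_mono i (f f' : FBL E) : (forall u, f u <= f' u) -> Psi (e i f) <= Psi (e i f').
  move=> ff'; rewrite -subr_le0 -eB; apply: Psi_le0 => j u.
  change ((if j \in [:: i] then f - f' else 0) u <= 0).
  by case: ifP => // _; rewrite -[leLHS]/(f u - f' u) subr_le0.
(* With [t] the indicator of [k] and [G = 0], the constraint for [- W] reads 0 on the whole block,
   so [q (- W)] is at most -1. *)
have Psi_block : 1 <= \sum_(a <- A k) Psi (e (k, a) (w (k, a))).
  have uk : uniq [seq ((k, a) : I) | a <- A k].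
    by rewrite map_inj_uniq// => a b [].
  have := restrE _ w uk; rewrite big_map => <-.
  set W := restriction _ _.
  rewrite -lerN2 -linearN; apply: le_trans (Psiq _) _; apply: q_le.
  exists (fun j => (j == k)%:R), k.+1, 0; split => //.
  - by move=> j kj; rewrite gtn_eqF.
  - move=> [j a] u.
    change (- (if (j, a) \in [seq ((k, a) : I) | a <- A k] then w (j, a) else 0) u +
      (if a \in A j then (j == k)%:R * w (j, a) u else 0) <= 0).
    have [->|jk] := eqVneq j k.
      rewrite mem_map; last by move=> b b' [].
      by case: ifP => _; rewrite ?mul1r addrC ?subrr// oppr0 addr0.
    rewrite mul0r if_same addr0 ifF ?oppr0//; apply/negP => /mapP[b _ [jk' _]].
    by rewrite jk' eqxx in jk.
  - rewrite normr0 mulr0 sub0r big_nat_recr//= eqxx big_nat_cond big1 ?add0r//.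
    by move=> j /andP[/andP[_ jk] _]; rewrite ltn_eqF.
apply: le_trans Psi_block _; rewrite [leLHS]big_seq [leRHS]big_seq.
apply: ler_sum => a aA; rewrite eB -XE.
apply: (@le_trans _ _ (X k a a - h k (X k a))); last first.
  by rewrite -[leRHS]/(g k (X k a) - h k (X k a)) lerD2r; exact: (Ag k).1.
rewrite lerD2l lerN2; have [b bB ->] := (Bh k).2 (X k a); rewrite XE.
by apply: Psi_mono => u; exact: (Bh k).1.
Qed.

End LowerEstimate.

Section LowerEstimateConsequence.
Context {R : realType}.

Lemma dual_sumE (E : normedModType R) (I : Type) (r : seq I) (F : I -> dual E) v :
  (\sum_(n <- r) F n) v = \sum_(n <- r) F n v.
Proof. exact: (big_morph (fun x : dual E => x v) (fun _ _ => erefl) erefl). Qed.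

(** The values of [g k - h k] at the [X k a] sum to at least 1 while its norm is at most [D], so the
    sum over [a] of [|X k a v|] is not small on the unit ball. Signed sums over [a], with signs
    chosen at a good vector [v k], then satisfy the hypotheses of [wuc_retract]. *)
Lemma sup_lower_l1_complemented (E : completeNormedModType R) (f : nat -> FBL E)
    (C c : R) : 0 < c -> (forall k, `|f k| <= C) -> sup_lower_l1 f c ->
  contains_complemented (ell1 R) E.
Proof.
move=> c0 fC fc; have C0 : 0 <= C by exact: le_trans (normr_ge0 _) (fC 0%N).
have [A' [B [g [h [A'g Bh ghC ghc]]]]] := sup_lower_l1_normal_form c0 fC fc.
pose A k := undup (A' k).
have Ag k : is_max_of (A k) (g k).
  have [gA Ag] := A'g k; split=> [a u|u]; first by rewrite mem_undup; exact: gA.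
  by have [a aA ga] := Ag u; exists a => //; rewrite mem_undup.
have c2 : 0 < c / 2 by rewrite divr_gt0.
have [X [XC X1]] := sup_lower_l1_functionals Ag Bh c2 ghc.
pose D := C + c / 2.
have D0 : 0 < D by rewrite /D; lra.
(* A family of size at most [e] would give [g k - h k] a total of at most [e * D], that is 1/2,
   against the lower bound 1. *)
pose e := (2 * D)^-1.
have e0 : 0 < e by rewrite invr_gt0 mulr_gt0.
have H k : {v : E | `|v| <= 1 & e <= \sum_(a <- A k) `|X k a v|}.
  apply/cid2; apply: contrapT => nv.
  have Xe v : \sum_(u <- map (X k) (A k)) `|u v| <= e * `|v|.
    rewrite big_map; have [->|v0] := eqVneq v 0.
      by rewrite normr0 mulr0 big1// => a _; rewrite dual0 normr0.
    have nv0 : 0 < `|v| by rewrite normr_gt0.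
    rewrite leNgt; apply/negP => ev; apply: nv; exists (`|v|^-1 *: v).
      by rewrite normrZ normfV normr_id mulVf ?gt_eqF.
    under eq_bigr do rewrite dualZ normrM normfV normr_id.
    by rewrite -mulr_sumr ler_pdivlMl// mulrC ltW.
  have := fbl_sum_le e0 Xe (g k - h k); rewrite big_map => Xgh.
  have := X1 k (undup_uniq _).
  have : \sum_(a <- A k) (g k - h k) (X k a) <= \sum_(a <- A k) `|(g k - h k) (X k a)|.
    by apply: ler_sum => a _; exact: ler_norm.
  have : e * `|g k - h k| <= e * D by rewrite (ler_wpM2l (ltW e0))//; exact: ghC.
  have -> : e * D = 2^-1 by rewrite /e invfM -mulrA mulVf ?gt_eqF// mulr1.
  by lra.
pose v k := s2val (H k).
pose y k : dual E := \sum_(a <- A k) Num.sg (X k a (v k)) *: X k a.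
apply: (@wuc_retract R E y v (c / 2)^-1 e) => //; first by rewrite invr_gt0.
- move=> x N; pose s := [seq (k, a) | k <- index_iota 0 N, a <- A k].
  have us : uniq s.
    apply: allpairs_uniq_dep; first exact: iota_uniq.
      by move=> k _; exact: undup_uniq.
    by move=> [k a] [k' a'] _ _ /= [-> ->].
  apply: le_trans (XC s x us); rewrite big_allpairs_dep/=.
  apply: ler_sum => k _; rewrite dual_sumE; apply: le_trans (ler_norm_sum _ _ _) _.
  apply: ler_sum => a _; rewrite dualZE normrM ler_piMl// normr_sg.
  by case: (_ == 0).
- by move=> k; exact: s2valP (H k).
- move=> k; apply: le_trans (s2valP' (H k)) _; rewrite dual_sumE.
  by apply: ler_sum => a _; rewrite dualZE -normrEsg.
Qed.

(** The supremum of disjoint positive elements is their sum: the join of the [t k *: ell1_basis k]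
    is [ell1_trunc t m], whose image lies below [G] and whose norm is controlled by that of its
    image. *)
Lemma lattice_ell1_sup_lower (E : normedModType R) (S : set (FBL E)) :
  lattice_isomorphic (ell1 R) S ->
  exists (f : nat -> FBL E) (C c : R),
    [/\ 0 < c, forall k, `|f k| <= C & sup_lower_l1 f c].
Proof.
move=> [T [[Tm Tj] TS]].
have [K K0 TK] := iso_onto_bounded_below TS; have [cT _ _] := TS.
have [C C0 TC] := (continuous_linearP T).1 cT.
exists (fun k => T (ell1_basis k)), C, K^-1; split; first by rewrite invr_gt0.
  by move=> k; apply: le_trans (TC _) _; rewrite ler_piMr ?ell1_basis_norm// ltW.
move=> t m G t0 G0 tG.
have TG : forall u, T (ell1_trunc t m) u <= G u.
  elim: m tG => [|m IH] tG u.
    have -> : ell1_trunc t 0 = 0 by exact/val_inj/funext.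
    by rewrite linear0.
  have -> : ell1_trunc t m.+1 = vjoin (ell1_trunc t m) (t m *: ell1_basis m).
    apply/val_inj/funext => n.
    change ((if (n < m.+1)%N then t n else 0) =
      Num.max (if (n < m)%N then t n else 0) (t m * ell1_basis m n)).
    rewrite ell1_basisE ltnS leq_eqVlt; case: eqVneq => [->|_]/=.
      by rewrite ltnn mulr1; apply/esym/max_idPr.
    by rewrite mulr0; apply/esym/max_idPl; case: ifP.
  rewrite Tj linearZ.
  change (Num.max (T (ell1_trunc t m) u) (t m * T (ell1_basis m) u) <= G u).
  rewrite ge_max IH ?tG// => k v km; exact: tG (leqW km).
have T0 u : 0 <= T (ell1_trunc t m) u.
  have -> : ell1_trunc t m = vjoin (ell1_trunc t m) 0.
    by apply/val_inj/funext => n; apply/esym/max_idPl => /=; case: ifP.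
  by rewrite Tj linear0 /= le_max lexx orbT.
rewrite ler_pdivrMl//; apply: (@le_trans _ _ `|ell1_trunc t m|).
  apply: le_trans (ell1_partial_le _ m); rewrite big_nat [leRHS]big_nat.
  by apply: ler_sum => n /andP[_ nm]; rewrite /= nm ler_norm.
apply: le_trans (TK _) _; rewrite (ler_wpM2l (ltW K0))//.
by apply: fbl_norm_mono => u; rewrite !ger0_norm.
Qed.

End LowerEstimateConsequence.

(** * Functionals on order intervals *)

Section OrderIntervals.
Context {R : realType} {E : normedModType R}.
Implicit Types (f g h : FBL E) (u : dual E).

(** The intervals of radius [f] around 0, [a + b], [a + c] and [b + c] meet pairwise, hence have a
    common point; [t] is their largest left endpoint. *)
Lemma three_intervals (a b c f : R) : `|a| <= f -> `|b| <= f -> `|c| <= f ->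
  let t := Num.max (- f) (Num.max (a + b) (Num.max (a + c) (b + c)) - f) in
  [/\ `|t| <= f, `|a + b - t| <= f, `|a + c - t| <= f & `|b + c - t| <= f].
Proof.
move=> /ler_normlP[a1 a2] /ler_normlP[b1 b2] /ler_normlP[c1 c2] t.
have t1 : - f <= t by rewrite le_max lexx.
have t2 : a + b <= t + f by rewrite -lerBlDr le_max lerD2r le_max lexx orbT.
have t3 : a + c <= t + f by rewrite -lerBlDr le_max lerD2r !le_max lexx !orbT.
have t4 : b + c <= t + f by rewrite -lerBlDr le_max lerD2r !le_max lexx !orbT.
have tle x : - f <= x -> a + b <= x + f -> a + c <= x + f -> b + c <= x + f -> t <= x.
  by move=> *; rewrite ge_max lerBlDr !ge_max; apply/and4P.
have := tle f; have := tle (a + b + f); have := tle (a + c + f); have := tle (b + c + f).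
move=> h1 h2 h3 h4; rewrite !ler_norml; split; apply/andP; split; try lra.
Qed.

(* [psi] is the best signed sum of the three functionals: with [t] as above, the values *)
(* of the four signed sums at [t], [g1 + g2 - t], [g1 + g3 - t] and [g2 + g3 - t] add *)
(* up to [2 (psi1 g1 + psi2 g2 + psi3 g3)]. *)
Lemma three_signs (psi1 psi2 psi3 : FBL E -> R) (f g1 g2 g3 : FBL E) :
  linear (psi1 : FBL E -> R^o) -> linear (psi2 : FBL E -> R^o) ->
  linear (psi3 : FBL E -> R^o) ->
  (forall u, `|g1 u| <= f u) -> (forall u, `|g2 u| <= f u) -> (forall u, `|g3 u| <= f u) ->
  exists psi : FBL E -> R, [/\ linear (psi : FBL E -> R^o),
    forall h, `|psi h| <= `|psi1 h| + `|psi2 h| + `|psi3 h| &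
    exists2 g : FBL E, forall u, `|g u| <= f u &
      (psi1 g1 + psi2 g2 + psi3 g3) / 2 <= psi g].
Proof.
move=> l1 l2 l3 g1f g2f g3f.
have combo (s1 s2 s3 : R) : `|s1| <= 1 -> `|s2| <= 1 -> `|s3| <= 1 ->
    let psi h := s1 * psi1 h + s2 * psi2 h + s3 * psi3 h in
    linear (psi : FBL E -> R^o) /\
    forall h, `|psi h| <= `|psi1 h| + `|psi2 h| + `|psi3 h|.
  move=> s11 s21 s31 psi; split=> [a x y|h].
    rewrite /psi l1 l2 l3.
    change (s1 * (a * psi1 x + psi1 y) + s2 * (a * psi2 x + psi2 y) +
      s3 * (a * psi3 x + psi3 y) = a * (s1 * psi1 x + s2 * psi2 x + s3 * psi3 x) +
      (s1 * psi1 y + s2 * psi2 y + s3 * psi3 y)); lra.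
  apply: le_trans (ler_normD _ _) _; apply: lerD; last by rewrite normrM ler_piMl.
  apply: le_trans (ler_normD _ _) _.
  by apply: lerD; rewrite normrM ler_piMl.
pose t : FBL E := vjoin (- f) (vjoin (g1 + g2) (vjoin (g1 + g3) (g2 + g3)) - f).
have tP u := three_intervals (g1f u) (g2f u) (g3f u).
have B (p : FBL E -> R) : linear (p : FBL E -> R^o) ->
    forall x y z, p (x + y - z) = p x + p y - p z.
  by move=> /mk_linear[L LE] x y z; rewrite -!LE linearB linearD.
have n1 : `|1| <= 1 :> R by rewrite normr1.
have nN1 : `|- 1| <= 1 :> R by rewrite normrN1.
have : exists s1 s2 s3 : R, [/\ `|s1| <= 1, `|s2| <= 1, `|s3| <= 1 &
    exists2 g : FBL E, forall u, `|g u| <= f u &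
      (psi1 g1 + psi2 g2 + psi3 g3) / 2 <= s1 * psi1 g + s2 * psi2 g + s3 * psi3 g].
  pose v := (psi1 g1 + psi2 g2 + psi3 g3) / 2.
  have [h1|h1] := leP v (1 * psi1 t + 1 * psi2 t + 1 * psi3 t).
    by exists 1, 1, 1; split => //; exists t => // u; have [] := tP u.
  have [h2|h2] := leP v (1 * psi1 (g1 + g2 - t) + 1 * psi2 (g1 + g2 - t) +
      -1 * psi3 (g1 + g2 - t)).
    by exists 1, 1, (-1); split => //; exists (g1 + g2 - t) => // u; have [] := tP u.
  have [h3|h3] := leP v (1 * psi1 (g1 + g3 - t) + -1 * psi2 (g1 + g3 - t) +
      1 * psi3 (g1 + g3 - t)).
    by exists 1, (-1), 1; split => //; exists (g1 + g3 - t) => // u; have [] := tP u.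
  exists (-1), 1, 1; split => //; exists (g2 + g3 - t) => [u|]; first by have [] := tP u.
  by move: h1 h2 h3; rewrite !(B _ l1) !(B _ l2) !(B _ l3) /v; lra.
move=> [s1 [s2 [s3 [s11 s21 s31 [g gf gE]]]]].
have [lp pb] := combo _ _ _ s11 s21 s31.
by exists (fun h => s1 * psi1 h + s2 * psi2 h + s3 * psi3 h); split => //; exists g.
Qed.

Context (phi : nat -> FBL E -> R) (K : R).
Hypotheses (lphi : forall n, linear (phi n : FBL E -> R^o)) (K0 : 0 < K).
Hypothesis phiK : forall h N, \sum_(0 <= n < N) `|phi n h| <= K * `|h|.

(* If infinitely many [phi n] exceed [e] on the order interval [[-f, f]], then by *)
(* [three_signs] signed sums of [3^m] of them exceed [(3/2)^m e] there, while all *)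
(* signed sums are bounded by [K |f|]. *)
Lemma wuc_order_interval f (e : R) : 0 < e -> exists N, forall n, (N <= n)%N ->
  forall h, (forall u, `|h u| <= f u) -> `|phi n h| <= e.
Proof.
move=> e0; apply: contrapT => nN.
have phiN n h : phi n (- h) = - phi n h.
  by have [L LE] := mk_linear (lphi n); rewrite -!LE linearN.
have large N : exists n (h : FBL E), [/\ (N <= n)%N, forall u, `|h u| <= f u & e <= phi n h].
  apply: contrapT => nh; apply: nN; exists N => n Nn h hf.
  rewrite ler_norml; apply/andP; split; rewrite leNgt; apply/negP => /ltW ephi;
    apply: nh; last by exists n, h.
  exists n, (- h); split => // [u|]; last by rewrite phiN lerNr.
  by rewrite -[(- h) u]/(- h u) normrN.
(* Three consecutive blocks of indices are merged at each step, which multiplies the value by 3/2.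
   The weaker linear bound [1 + m / 2] already contradicts boundedness. *)
have grow m N : exists N' psi, [/\ (N <= N')%N, linear (psi : FBL E -> R^o),
    forall h, `|psi h| <= \sum_(N <= n < N') `|phi n h| &
    exists2 h : FBL E, forall u, `|h u| <= f u & (1 + m%:R / 2) * e <= psi h].
  elim: m N => [|m IH] N.
    have [n [h [Nn hf eh]]] := large N.
    exists n.+1, (phi n); split => //; first exact: leqW.
      by move=> k; rewrite big_nat_recr//= lerDr sumr_ge0.
    by exists h => //; rewrite mul0r addr0 mul1r.
  have [N1 [psi1 [NN1 l1 b1 [g1 g1f e1]]]] := IH N.
  have [N2 [psi2 [NN2 l2 b2 [g2 g2f e2]]]] := IH N1.
  have [N3 [psi3 [NN3 l3 b3 [g3 g3f e3]]]] := IH N2.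
  have [psi [lp pb [g gf gE]]] := three_signs l1 l2 l3 g1f g2f g3f.
  exists N3, psi; split => //.
  - exact: leq_trans NN1 (leq_trans NN2 NN3).
  - move=> h; apply: le_trans (pb h) _.
    rewrite (big_cat_nat NN1) ?(leq_trans NN2)//= (big_cat_nat NN2)//=.
    by have := b1 h; have := b2 h; have := b3 h; lra.
  - exists g => //; apply: le_trans gE; rewrite -natr1.
    have : 0 <= m%:R * e :> R by rewrite mulr_ge0// ltW.
    by move: e1 e2 e3; lra.
pose m := Num.bound (2 * (K * `|f|) / e).
have [N [psi [_ _ pb [h hf hE]]]] := grow m 0%N.
have : 2 * (K * `|f|) / e < m%:R.
  by apply: archi_boundP; rewrite divr_ge0 ?(ltW e0)// !mulr_ge0// ltW.
rewrite ltr_pdivrMr//.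
have : K * `|h| <= K * `|f|.
  rewrite (ler_wpM2l (ltW K0))//; apply: fbl_norm_mono => u.
  exact: le_trans (hf u) (ler_norm _).
by have := phiK h N; have := pb h; have := ler_norm (psi h); lra.
Qed.

(* The best choice of signs in [(sum_k e_k phi_k) (sum_k e_k g_k)] is at least *)
(* the average over all signs. *)
Lemma wuc_diagonal (g : nat -> FBL E) (F : FBL E) m :
  (forall u, \sum_(0 <= k < m) `|g k u| <= F u) ->
  \sum_(0 <= k < m) phi k (g k) <= K * `|F|.
Proof.
move=> gF.
have [psi [G [lp pb Gg gG]]] : exists psi (G : FBL E), [/\ linear (psi : FBL E -> R^o),
    forall h, `|psi h| <= \sum_(0 <= k < m) `|phi k h|,
    forall u, `|G u| <= \sum_(0 <= k < m) `|g k u| &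
    \sum_(0 <= k < m) phi k (g k) <= psi G].
  elim: m {gF} => [|m [psi [G [lp pb Gg gG]]]].
    exists (fun=> 0), 0; split => [a x y|h|u|].
    - by rewrite scaler0 addr0.
    - by rewrite normr0 sumr_ge0.
    - by rewrite normr0 sumr_ge0.
    - by rewrite big_geq.
  have step (s : R) : `|s| = 1 ->
      let psi' h := psi h + s * phi m h in let G' : FBL E := G + s *: g m in
      [/\ linear (psi' : FBL E -> R^o),
        forall h, `|psi' h| <= \sum_(0 <= k < m.+1) `|phi k h|,
        forall u, `|G' u| <= \sum_(0 <= k < m.+1) `|g k u| &
        psi' G' = psi G + s * psi (g m) + s * phi m G + s * s * phi m (g m)].
    move=> s1 psi' G'; split => [a x y|h|u|].
    - rewrite /psi' lp lphi.
      change (a * psi x + psi y + s * (a * phi m x + phi m y) =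
        a * (psi x + s * phi m x) + (psi y + s * phi m y)); lra.
    - rewrite big_nat_recr//=; apply: le_trans (ler_normD _ _) _.
      by rewrite normrM s1 mul1r lerD.
    - rewrite -[G' u]/(G u + s * g m u) big_nat_recr//=.
      apply: le_trans (ler_normD _ _) _.
      by rewrite normrM s1 mul1r lerD.
    - rewrite /psi' /G' [G + _]addrC lp lphi.
      change (s * psi (g m) + psi G + s * (s * phi m (g m) + phi m G) =
        psi G + s * psi (g m) + s * phi m G + s * s * phi m (g m)); lra.
  have [a1 a2 a3 a4] := step 1 (normr1 _).
  have [b1 b2 b3 b4] := step (-1) (normrN1 _).
  have [h|h] := leP 0 (psi (g m) + phi m G).
    by do 2 eexists; split; [exact: a1|exact: a2|exact: a3|];
      rewrite /= a4 big_nat_recr//=; lra.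
  by do 2 eexists; split; [exact: b1|exact: b2|exact: b3|];
    rewrite /= b4 big_nat_recr//=; lra.
apply: le_trans gG _; apply: le_trans (ler_norm _) _; apply: le_trans (pb G) _.
apply: le_trans (phiK G m) _; rewrite (ler_wpM2l (ltW K0))//.
by apply: fbl_norm_mono => u; apply: le_trans (ler_norm _); exact: le_trans (gF u).
Qed.

End OrderIntervals.

(** * Complemented copies of l1 in FBL *)

Section ComplementedLowerEstimate.
Context {R : realType}.

(** What is cut off when [x] is clipped to modulus [M] has as modulus the increment of the running
    maximum, so these moduli telescope. *)
Lemma sub_clip_norm (x M : R) : 0 <= M ->
  `|Num.max (- M) (Num.min M x)| <= M /\
  `|x - Num.max (- M) (Num.min M x)| = Num.max M `|x| - M.
Proof.
move=> M0; have [Mx|xM] := leP M x.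
  rewrite (max_idPr (_ : - M <= M)); last by lra.
  rewrite (max_idPr (_ : M <= `|x|)); last by rewrite ger0_norm//; lra.
  rewrite [in RHS]ger0_norm; last by lra.
  by rewrite !ger0_norm//; lra.
have [Mx|xM'] := leP (- M) x.
  rewrite subrr normr0 (max_idPl (_ : `|x| <= M)) ?subrr//.
    by rewrite ler_norml Mx ltW.
  by rewrite ler_norml Mx ltW.
rewrite (max_idPr (_ : M <= `|x|)); last by rewrite ler0_norm//; lra.
rewrite normrN ger0_norm// opprK [in RHS]ler0_norm; last by lra.
by rewrite ler0_norm; [split; lra|lra].
Qed.

(* Along a subsequence, [phi k] is small on the order interval generated by the *)
(* earlier [|f i|]. Cutting [t k f k] down by [M k = max_(i < k) t i |f i|] leaves *)
(* elements whose moduli [M k.+1 - M k] telescope to [max_(i < m) t i |f i|], *)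
(* at the cost of a small error in the values of [phi k]. *)
Lemma complemented_sup_lower (E : normedModType R) :
  contains_complemented (ell1 R) (FBL E) ->
  exists (f : nat -> FBL E) (C c : R),
    [/\ 0 < c, forall k, `|f k| <= C & sup_lower_l1 f c].
Proof.
move=> /complemented_retractP[T [Q [cT cQ TQ]]].
have [C C0 TC] := (continuous_linearP T).1 cT.
have [K K0 QK] := (continuous_linearP Q).1 cQ.
pose phi n (h : FBL E) := Q h n.
have lphi n : linear (phi n : FBL E -> R^o).
  by move=> a x y; rewrite /phi linearP.
have phiK h N : \sum_(0 <= n < N) `|phi n h| <= K * `|h|.
  exact: le_trans (ell1_partial_le (Q h) N) (QK h).
have idx (F : FBL E) (k : nat) : {N | forall n, (N <= n)%N ->
    forall h : FBL E, (forall u, `|h u| <= F u) -> `|phi n h| <= geom k / 4}.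
  apply/cid; apply: (wuc_order_interval lphi K0 phiK).
  by rewrite divr_gt0// geom_gt0.
pose f n := T (ell1_basis n).
(* [state k] holds a strict upper bound for the indices chosen so far and the sum of their
   [fbl_abs (f n)]; the next index lies beyond both this bound and the threshold given by [idx] for
   that sum. *)
pose next k (LF : nat * FBL E) := let n := maxn LF.1 (sval (idx LF.2 k)) in
  (n.+1, LF.2 + fbl_abs (f n)).
pose state := fix state k := if k is k'.+1 then next k' (state k') else (0%N, 0 : FBL E).
pose n_ k := maxn (state k).1 (sval (idx (state k).2 k)).
have state1 k : (state k.+1).1 = (n_ k).+1 by [].
have state2 k u : (state k.+1).2 u = (state k).2 u + `|f (n_ k) u|.
  by rewrite -fbl_absE.
have n_lt i k : (i < k)%N -> (n_ i < n_ k)%N.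
  elim: k => // k IH; have nS : (n_ k < n_ k.+1)%N.
    by rewrite {2}/n_ state1 leq_max leqnn.
  by rewrite ltnS leq_eqVlt => /predU1P[->//|/IH/ltn_trans]; exact.
have n_inj : injective n_.
  move=> i k nik; have [ik|ki|//] := ltngtP i k.
    by have := n_lt _ _ ik; rewrite nik ltnn.
  by have := n_lt _ _ ki; rewrite nik ltnn.
have small k (h : FBL E) : (forall u, `|h u| <= (state k).2 u) ->
    `|phi (n_ k) h| <= geom k / 4.
  by move=> hk; apply: (svalP (idx (state k).2 k)) => //; exact: leq_maxr.
have stateE k u : (state k).2 u = \sum_(0 <= i < k) `|f (n_ i) u|.
  elim: k => [|k IH]; first by rewrite big_geq.
  by rewrite state2 big_nat_recr//= IH.
exists (fun k => fbl_abs (f (n_ k))), C, (2 * K)^-1; split.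
- by rewrite invr_gt0 mulr_gt0.
- move=> k; apply: le_trans (fbl_abs_norm _) _; apply: le_trans (TC _) _.
  by rewrite ler_piMr ?ell1_basis_norm// ltW.
move=> t m G t0 G0 tG.
pose S := \sum_(0 <= k < m) t k.
have S0 : 0 <= S by apply: sumr_ge0.
rewrite ler_pdivrMl ?mulr_gt0// -/S -mulrA.
have [->|Sn0] := eqVneq S 0; first by rewrite !mulr_ge0// ltW.
have {Sn0}S0' : 0 < S by rewrite lt_neqAle eq_sym Sn0.
pose x k : FBL E := t k *: f (n_ k).
have xE k u : `|x k u| = t k * `|f (n_ k) u|.
  by rewrite -[x k u]/(t k * f (n_ k) u) normrM ger0_norm.
pose M := fix M k : FBL E := if k is k'.+1 then vjoin (M k') (fbl_abs (x k')) else 0.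
have MS k u : M k.+1 u = Num.max (M k u) `|x k u|.
  by rewrite -fbl_absE.
have M0 k u : 0 <= M k u.
  by elim: k => [|k IH]; [exact: lexx|rewrite MS le_max IH].
have MG k u : (k <= m)%N -> M k u <= G u.
  elim: k => [_|k IH km]; first exact: G0.
  by rewrite MS ge_max IH ?(ltnW km)// xE -fbl_absE tG.
(* Each [t i] with [i < m] is at most [S], so [S^-1 *: clip k] lies in the order interval on which
   [phi (n_ k)] is small. *)
have Mstate k u : (k <= m)%N -> M k u <= S * (state k).2 u.
  elim: k => [_|k IH km]; first by rewrite mulr0.
  rewrite MS state2 mulrDr ge_max; apply/andP; split.
    by apply: le_trans (IH (ltnW km)) _; rewrite lerDl mulr_ge0.
  apply: (@le_trans _ _ (S * `|f (n_ k) u|)).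
    rewrite xE ler_wpM2r// /S (bigD1_seq k) ?iota_uniq ?mem_index_iota//= lerDl.
    exact: sumr_ge0.
  by rewrite lerDr mulr_ge0// stateE sumr_ge0.
pose clip k : FBL E := vjoin (- M k) (vmeet (M k) (x k)).
have clipP k u := sub_clip_norm (x k u) (M0 k u).
have clip_small k : (k < m)%N -> `|phi (n_ k) (clip k)| <= S * (geom k / 4).
  move=> km; have : `|phi (n_ k) (S^-1 *: clip k)| <= geom k / 4.
    apply: small => u; rewrite -[(S^-1 *: clip k) u]/(S^-1 * clip k u) normrM normfV.
    rewrite (gtr0_norm S0') ler_pdivrMl//.
    by apply: le_trans (Mstate k u (ltnW km)); have [] := clipP k u.
  rewrite /phi linearZ -[(S^-1 *: Q (clip k)) (n_ k)]/(S^-1 * Q (clip k) (n_ k)) normrM normfV.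
  by rewrite (gtr0_norm S0') ler_pdivrMl.
pose psi k := phi (n_ k).
have psiK h N : \sum_(0 <= k < N) `|psi k h| <= K * `|h|.
  rewrite -(big_map n_ xpredT (fun n => `|phi n h|)).
  have [||N'] := @sum_uniq_le R (fun n => `|phi n h|) (map n_ (index_iota 0 N)) => //.
    by rewrite map_inj_uniq// iota_uniq.
  by move=> /le_trans; apply.
have := @wuc_diagonal R E psi K (fun k => lphi (n_ k)) K0 psiK (fun k => x k - clip k) G m.
move=> /(_ _)/wrap[u|].
  have -> : \sum_(0 <= k < m) `|(x k - clip k) u| = M m u.
    elim: (m) => [|k IH]; first by rewrite big_geq.
    rewrite MS big_nat_recr// IH; have [_] := clipP k u.
    rewrite -[(x k - clip k) u]/(x k u - clip k u) => ->.
    by rewrite /= addrC subrK.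
  exact: MG.
have phif k : psi k (x k) = t k.
  rewrite /psi /phi linearZ -[(t k *: Q (f (n_ k))) (n_ k)]/(t k * Q (f (n_ k)) (n_ k)) /f TQ.
  by rewrite ell1_basisE eqxx mulr1.
have -> : \sum_(0 <= k < m) psi k (x k - clip k) =
    S - \sum_(0 <= k < m) psi k (clip k).
  rewrite /S -sumrB; apply: eq_bigr => k _; rewrite -[in RHS]phif.
  by rewrite /psi /phi linearB.
(* The errors [S * 2^-k / 4] add up to at most [S / 2]; the remaining [S / 2] accounts for the
   constant [(2 * K)^-1]. *)
have : \sum_(0 <= k < m) psi k (clip k) <= S / 2.
  apply: (@le_trans _ _ (\sum_(0 <= k < m) S * (geom k / 4))).
    rewrite big_nat [leRHS]big_nat; apply: ler_sum => k /andP[_ km].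
    by apply: le_trans (ler_norm _) _; exact: clip_small.
  rewrite -mulr_sumr -mulr_suml (ler_wpM2l S0)//.
  have := @geom_sum R 0 m; rewrite /geom expr0; lra.
by lra.
Qed.

End ComplementedLowerEstimate.
Theorem theorem9p20 (R : realType) (E : completeNormedModType R) :
  [<-> contains_complemented (ell1 R) E;
       exists S : set (FBL E),
         [/\ is_sublattice S, lattice_complemented S
           & lattice_isomorphic (FBL (ell1 R)) S];
       exists S : set (FBL E),
         [/\ is_sublattice S, lattice_complemented S
           & lattice_isomorphic (ell1 R) S];
       exists T : {linear FBL E -> ell1 R}, lattice_hom T /\ range T = setT;
       exists S : set (FBL E),
         [/\ is_sublattice S, closed S & lattice_isomorphic (ell1 R) S];
       contains_complemented (ell1 R) (FBL E)].
Proof.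
have quotient_retract (T : {linear FBL E -> ell1 R}) : lattice_hom T /\ range T = setT ->
    exists S : {linear ell1 R -> FBL E},
      [/\ lattice_hom S, continuous S, continuous T & cancel S T].
  move=> [hT sT]; have [S [hS cS ST]] := hom_section hT sT.
  by exists S; split => //; exact: hom_continuous hT.
have onto_retract : (exists T : {linear FBL E -> ell1 R}, lattice_hom T /\ range T = setT) ->
    exists S : set (FBL E), [/\ is_sublattice S, lattice_complemented S,
      lattice_isomorphic (ell1 R) S & closed S].
  move=> [T hT]; have [S [hS cS cT ST]] := quotient_retract T hT.
  by exists (range S); exact: lattice_retract hS hT.1 cS cT ST.
have P01 : contains_complemented (ell1 R) E -> exists S : set (FBL E),
    [/\ is_sublattice S, lattice_complemented S & lattice_isomorphic (FBL (ell1 R)) S].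
  move=> /complemented_retractP[A [B [cA cB AB]]].
  have [T [Q [hT hQ cT cQ TQ]]] := fbl_map_retract cA cB AB.
  by exists (range T); have [] := lattice_retract hT hQ cT cQ TQ.
have P1onto : (exists S : set (FBL E),
    [/\ is_sublattice S, lattice_complemented S & lattice_isomorphic (FBL (ell1 R)) S]) ->
    exists T : {linear FBL E -> ell1 R}, lattice_hom T /\ range T = setT.
  move=> [S [_ cS iS]]; have [Q [[Qm Qj] sQ]] := lattice_complemented_onto cS iS.
  have [b [[bm bj] sb]] := @fbl_ell1_onto R.
  exists (b \o Q : {linear FBL E -> ell1 R}); split.
    by split=> x y /=; rewrite ?Qm ?Qj ?bm ?bj.
  apply/seteqP; split=> // x _; have [z _ <-] : range b x by rewrite sb.
  by have [y _ <-] : range Q z; [rewrite sQ|exists y].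
tfae.
- exact: P01.
- move=> /P1onto/onto_retract[S [? ? ? _]]; by exists S.
- by move=> [S [_ cS iS]]; exact: lattice_complemented_onto cS iS.
- by move=> /onto_retract[S [? _ ? ?]]; exists S.
(* No projection onto the given sublattice is sought: the estimate leads back to (1), hence to a
   quotient map onto l1, whose section spans another, complemented, copy. *)
- move=> [S [_ _ iS]].
  have [f [C [c [c0 fC fc]]]] := lattice_ell1_sup_lower iS.
  have /P01/P1onto[T hT] := sup_lower_l1_complemented c0 fC fc.
  have [S' [_ cS' cT S'T]] := quotient_retract T hT.
  by apply/complemented_retractP; exists S', T.
- move=> /complemented_sup_lower[f [C [c [c0 fC fc]]]].
  exact: sup_lower_l1_complemented c0 fC fc.
Qed.
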